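(* Let $m>1$, let $P\subset\mathbb E^{2m}$ be a neighbourly $2m$-polytope with at least $2m+3$ vertices, and let $\mathcal T=\{\Phi_1,\ldots,\Phi_m\}$ be a universal tower in $P$ given by the vertices $x_1,y_1,\ldots,x_m,y_m$, with $\Phi_0=\emptyset$. Let $P^+=[P,\bar x]$ be obtained by sewing $\bar x$ onto $P$ through $\mathcal T$. For $1\le i\le m$, let $\mathcal T^*$ be the universal tower of $P/\Phi_i$ corresponding to $\mathcal T$, that is, $\mathcal T^*$ consists of all $\Phi_n^*$ with $n>i$, and let $(P/\Phi_i)^+=[P/\Phi_i,\bar y^*]$ be obtained by sewing $\bar y^*$ onto $P/\Phi_i$ through $\mathcal T^*$. Then, for $1\le i\le m$, $$(P/\Phi_i)^+\cong P^+/[\Phi_{i-1},x_i,\bar x],$$ where the bijection $\varphi$ of the vertices is given by $v^*\mapsto v^{**}$ if $v\in\mathcal V(P)\setminus\mathcal V(\Phi_i)$, and $\bar y^*\mapsto y_i^{**}$.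
   Context: $[A]$ denotes the convex hull; inside brackets, polytopes and points may be listed together. $\mathcal V(Q)$ is the vertex set of a polytope $Q$. A $d$-polytope is neighbourly if every $\lfloor d/2\rfloor$ of its vertices determine a proper face. For a face $G$ of $Q$, the quotient $Q/G$ is a polytope (defined up to combinatorial equivalence) of dimension $\dim Q-\dim G-1$ whose face lattice is isomorphic to the interval $[G,Q]$ of the face lattice of $Q$. The symbol $\cong$ denotes combinatorial equivalence (isomorphism of face lattices). Universal faces: a $k$-face $U$ of a neighbourly polytope $Q$ is universal if either $Q/U$ is a neighbourly polytope with $|\mathcal V(Q)|-k-1$ vertices, or $U$ is a facet of $Q$. $\mathcal U_k(Q)$ is the set of universal $k$-faces of $Q$. Universal towers: let $Q$ be a neighbourly $2r$-polytope, and let $x_1,\ldots,x_r,y_1,\ldots,y_r$ be distinct vertices of $Q$. Put $\Phi_0=\emptyset$ and $\Phi_j=[\Phi_{j-1},x_j,y_j]$ for $1\le j\le r$. Then $\mathcal T=\{\Phi_1,\ldots,\Phi_r\}$ is a universal tower in $Q$ if $\Phi_j\in\mathcal U_{2j-1}(Q)$ for all $j=1,\ldots,r$. Sewing: let $\mathscr F_0$ be the set of all facets of $Q$, $\mathscr F_j$ the set of facets of $Q$ containing $\Phi_j$ for $1\le j\le r$, and $\mathscr F_j=\emptyset$ for $j>r$. Put $\mathcal C(\mathcal T)=(\mathscr F_1\setminus\mathscr F_2)\cup(\mathscr F_3\setminus\mathscr F_4)\cup\cdots$. A point $x\notin\operatorname{aff}F$ is beyond a facet $F$ of $Q$ if $\operatorname{aff}F$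 separates $Q$ and $x$, and beneath $F$ otherwise. A point $\bar x$ lies exactly beyond $\mathcal C(\mathcal T)$ if it is beyond every $F\in\mathcal C(\mathcal T)$ and beneath every $F\in\mathscr F_0\setminus\mathcal C(\mathcal T)$. For such $\bar x$, the polytope $Q^+=[Q,\bar x]$ is said to be obtained by sewing $\bar x$ onto $Q$ through $\mathcal T$. Quotient notation: since $\Phi_i$ is universal in $P$, to every vertex $v\in\mathcal V(P)\setminus\mathcal V(\Phi_i)$ there corresponds a vertex $v^*$ of $P/\Phi_i$, and $P/\Phi_i$ is a neighbourly $(2m-2i)$-polytope. For $n>i$, $\Phi_n^*$ is the face of $P/\Phi_i$ that corresponds to $\Phi_n$; it is universal in $P/\Phi_i$. The face $[\Phi_{i-1},x_i,\bar x]$ of $P^+$ is universal in $P^+$ (Shemer), and for $v\in\mathcal V(P^+)\setminus(\mathcal V(\Phi_{i-1})\cup\{x_i,\bar x\})$, $v^{**}$ denotes the corresponding vertex of $P^+/[\Phi_{i-1},x_i,\bar x]$. *)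

(* Defs.v *)
From HB Require Import structures.
From mathcomp Require Import all_boot all_order all_algebra.
From mathcomp Require Import mathcomp_extra boolp classical_sets functions.
From mathcomp Require Import cardinality reals convex.
Set Implicit Arguments.
Unset Strict Implicit.
Unset Printing Implicit Defensive.
Import Order.TTheory GRing.Theory Num.Theory.
Local Open Scope classical_set_scope.
Local Open Scope card_scope.
Local Open Scope ring_scope.

(* Polytopes are represented by their point sets, and E^d by 'rV[R]_d. *)

Section Polytopes.
Context {R : realType} {d : nat}.
Notation V := 'rV[R]_d.
Implicit Types (A Q F G : set V) (v z : V).

Definition hull A : set V := smallest (@convex_set R V) A.

Definition aff A : set V :=
  [set z | exists (n : nat) (p : 'I_n -> V) (w : 'I_n -> R),
    [/\ forall i, A (p i), \sum_i w i = 1 & z = \sum_i w i *: p i]].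

(* The rows of p are affinely independent iff the rows (1, p_i) are linearly
   independent; the maximal number of such rows in A is dim A + 1 (at most
   d + 1). In particular pdim set0 = -1. *)
Definition pdim A : int :=
  (\max_(k < d.+2 | `[< exists2 p : 'M[R]_(k, d), forall i, A (row i p) &
      row_free (row_mx (const_mx 1 : 'M[R]_(k, 1)) p) >]) k)%:Z - 1.

Definition polytope Q := exists2 S : set V, finite_set S & Q = hull S.

(* c = 0 is allowed, so set0 and (for nonempty Q) Q itself are faces. *)
Definition face Q : set (set V) :=
  [set F | exists (c : 'cV[R]_d) (b : R),
    (forall z, Q z -> (z *m c) 0 0 <= b) /\
    F = Q `&` [set z | (z *m c) 0 0 = b]].

Definition vertices Q : set V := [set v | face Q [set v]].

Definition facets Q : set (set V) :=
  [set F | face Q F /\ pdim F = pdim Q - 1].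

(* The smallest face of Q containing A (for A `<=` Q). *)
Definition face_closure Q A : set V :=
  \bigcap_(F in [set F | face Q F /\ A `<=` F]) F.

(* The interval [G, Q] of the face lattice of Q. *)
Definition faces_above Q G : set (set V) := [set F | face Q F /\ G `<=` F].

(* The empty face counts as a proper face. *)
Definition neighbourly (k : nat) Q :=
  [/\ polytope Q, pdim Q = k%:Z &
      forall S, S `<=` vertices Q -> S #= `I_(k./2) ->
        face Q (hull S) /\ hull S <> Q].

Definition separated Q F z :=
  exists (c : 'cV[R]_d) (b : R),
    [/\ aff F = [set u | (u *m c) 0 0 = b],
        forall u, Q u -> (u *m c) 0 0 <= b & b < (z *m c) 0 0].

Definition beyond Q F z := ~ aff F z /\ separated Q F z.
Definition beneath Q F z := ~ aff F z /\ ~ separated Q F z.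

Definition exactly_beyond Q (C : set (set V)) z :=
  C `<=` [set F | beyond Q F z] /\ facets Q `\` C `<=` [set F | beneath Q F z].

(* Psi 1, ..., Psi r are the members of a tower in Q. *)
Definition facets_through Q (r : nat) (Psi : nat -> set V) (j : nat) :
    set (set V) :=
  if j == 0%N then facets Q
  else if (j <= r)%N then [set F | facets Q F /\ Psi j `<=` F]
  else set0.

Definition sewing_family Q r Psi : set (set V) :=
  \bigcup_(k in [set: nat])
    (facets_through Q r Psi (2 * k + 1) `\` facets_through Q r Psi (2 * k + 2)).

Definition sewn Q r Psi z Qp :=
  exactly_beyond Q (sewing_family Q r Psi) z /\ Qp = hull (Q `|` [set z]).

(* Phi x y j = [x_1, y_1, ..., x_j, y_j]; indices start at 1. *)
Fixpoint Phi (x y : nat -> V) (j : nat) : set V :=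
  if j is j'.+1 then hull (Phi x y j' `|` [set x j; y j]) else set0.

End Polytopes.

Section Quotients.
Context {R : realType}.

(* An order isomorphism between two families of sets; the values of f outside
   L are irrelevant. *)
Definition lattice_iso {d d' : nat} (L : set (set 'rV[R]_d))
    (L' : set (set 'rV[R]_d')) (f : set 'rV[R]_d -> set 'rV[R]_d') :=
  set_bij L L' f /\
  forall F G, L F -> L G -> (F `<=` G <-> f F `<=` f G).

(* phi is a bijection of the vertices inducing an isomorphism of the face
   lattices. *)
Definition comb_equiv {d d' : nat} (P : set 'rV[R]_d) (Q : set 'rV[R]_d')
    (phi : 'rV[R]_d -> 'rV[R]_d') :=
  set_bij (vertices P) (vertices Q) phi /\
  exists2 Theta, lattice_iso (face P) (face Q) Theta &
    forall v, vertices P v -> Theta [set v] = [set phi v].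

(* Q' is a realization of the quotient Q/G, with psi identifying [G, Q] and the
   face lattice of Q'. *)
Definition quotient {d d' : nat} (Q G : set 'rV[R]_d) (Q' : set 'rV[R]_d')
    (psi : set 'rV[R]_d -> set 'rV[R]_d') :=
  [/\ face Q G, polytope Q', pdim Q' = pdim Q - pdim G - 1 &
      lattice_iso (faces_above Q G) (face Q') psi].

(* w is the vertex of Q/G corresponding to the vertex v of Q. The face closure
   is [G, v] whenever that is a face; if G is a facet it is Q, and w is then
   the only point of Q/G. *)
Definition quotient_vertex {d d' : nat} (Q G : set 'rV[R]_d)
    (psi : set 'rV[R]_d -> set 'rV[R]_d') (v : 'rV[R]_d) (w : 'rV[R]_d') :=
  psi (face_closure Q (G `|` [set v])) = [set w].

Definition universal {d : nat} (k : nat) (Q U : set 'rV[R]_d) :=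
  [/\ face Q U, pdim U = k%:Z &
      facets Q U \/
      exists (d' k' n : nat) (Q' : set 'rV[R]_d')
             (psi : set 'rV[R]_d -> set 'rV[R]_d'),
        [/\ quotient Q U Q' psi, neighbourly k' Q',
            vertices Q #= `I_(n + k + 1) & vertices Q' #= `I_n]].

Definition universal_tower {d : nat} (Q : set 'rV[R]_d) (r : nat)
    (x y : nat -> 'rV[R]_d) :=
  [/\ forall j, (1 <= j <= r)%N -> vertices Q (x j) /\ vertices Q (y j),
      uniq ([seq x j | j <- iota 1 r] ++ [seq y j | j <- iota 1 r]) &
      forall j, (1 <= j <= r)%N -> universal (2 * j - 1) Q (Phi x y j)].

End Quotients.

(* Main.v *)
Require Import Defs.
From HB Require Import structures.
From mathcomp Require Import all_boot all_order all_algebra.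
From mathcomp Require Import mathcomp_extra boolp classical_sets functions.
From mathcomp Require Import cardinality reals convex.
From mathcomp Require Import ring lra interval_inference zify finmap.
Set Implicit Arguments.
Unset Strict Implicit.
Unset Printing Implicit Defensive.
Import Order.TTheory GRing.Theory Num.Theory.
Local Open Scope classical_set_scope.
Local Open Scope card_scope.
Local Open Scope ring_scope.

(* Call the level of a facet of P the largest j such that it contains Phi_j; the
   sewn point is beyond exactly the facets of odd level. A face of P+ through
   xbar is [F, xbar] for a face F of P lying in facets of both parities, and a
   face of (P/Phi_i)+ is F* or [F*, ybar], where F contains Phi_i and lies in a
   facet of the parity of i, respectively in facets of both parities. The
   isomorphism sends [F*, ybar] to [F, xbar], and F* to [F minus y_i, xbar].
   It is well defined because neighbourly polytopes of even dimension are
   simplicial and because a facet through Phi_(i-1) that misses y_i has level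
   i - 1. It is onto because a facet of the parity of i through Phi_(i-1) must
   contain Phi_i, so that y_i can be added to the faces inside it.

   Faces are handled through affine functionals that are nonpositive on the
   polytope; a face and a point off it are separated by a facet obtained by
   tilting such a functional. *)

(** * Affine functionals, convex hulls and faces *)

(** The mechanism is an exchange: in P+ the sewn point replaces y_i beside x_i in the tower, and y_i
    in turn plays the part of ybar in the quotient. Parities enter through the sign of a functional
    at the sewn point. A nonzero functional that is valid on P and zero at xbar can be tilted to
    facets on either side of xbar. Conversely, functionals of one facet beyond and one beneath can
    be used to correct a functional of a common face until its value at xbar cancels. This turns all
    metric information about xbar and ybar, which live in unrelated spaces, into statements about
    facets of P, the only data that P and P/Phi_i share. The remaining obstacle is that neither
    [psi] nor the operation of deleting y_i is given by a formula on point sets. The correspondence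
    is therefore set up as a relation between faces, tested on vertices, and becomes a function only
    once it is total, onto and monotone in both directions. *)

Section AffineFunctionals.
Context {R : realType} {d : nat}.
Notation V := 'rV[R]_d.
Implicit Types (f g h : 'cV[R]_(1 + d)) (z u v s : V) (A B Q F X : set V).

(** Homogenization: affine functionals become column vectors and affine dependences become linear
    ones, so that ranks, kernels and inverses of matrices apply. *)
Definition homog z : 'rV[R]_(1 + d) := row_mx (const_mx 1) z.

Definition ev f z : R := (homog z *m f) 0 0.

Lemma evD f g z : ev (f + g) z = ev f z + ev g z.
Proof. by rewrite /ev mulmxDr mxE. Qed.

Lemma evZ a f z : ev (a *: f) z = a * ev f z.
Proof. by rewrite /ev -scalemxAr mxE. Qed.

Lemma evN f z : ev (- f) z = - ev f z.
Proof. by rewrite /ev mulmxN mxE. Qed.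

Lemma ev0 z : ev 0 z = 0.
Proof. by rewrite /ev mulmx0 mxE. Qed.

Lemma ev_col (a : R) (c : 'cV[R]_d) z :
  ev (col_mx (const_mx a) c) z = a + (z *m c) 0 0.
Proof.
rewrite /ev /homog mul_row_col !mxE big_ord1 !mxE mul1r; congr (_ + _).
Qed.

Lemma ev_entries f z : ev f z = f 0 0 + (z *m dsubmx f) 0 0.
Proof.
rewrite -ev_col; congr (ev _ z); rewrite -[LHS]vsubmxK; congr col_mx.
by apply/matrixP => i j; rewrite !mxE !ord1; congr (f _ _); exact/val_inj.
Qed.

Lemma ev_comb f n (w : 'I_n -> R) (p : 'I_n -> V) : \sum_i w i = 1 ->
  ev f (\sum_i w i *: p i) = \sum_i w i * ev f (p i).
Proof.
move=> w1; have -> : ev f (\sum_i w i *: p i)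
   = ((\sum_i w i *: homog (p i)) *m f) 0 0.
  congr ((_ *m _) 0 0); apply/rowP => k; rewrite summxE.
  rewrite -(fintype.splitK k); case: (fintype.split k) => j /=; rewrite /homog.
    rewrite row_mxEl mxE -[LHS]w1; apply: eq_bigr => l _.
    by rewrite [RHS]mxE row_mxEl mxE mulr1.
  rewrite row_mxEr summxE; apply: eq_bigr => l _.
  by rewrite [LHS]mxE [RHS]mxE row_mxEr.
rewrite mulmx_suml summxE; apply: eq_bigr => l _.
by rewrite -scalemxAl mxE.
Qed.

Definition zeros f : set V := [set z | ev f z = 0].

Definition valid f A := forall z, A z -> ev f z <= 0.

Lemma faceP Q F : face Q F <-> exists2 f, valid f Q & F = Q `&` zeros f.
Proof.
split=> [[c [b [cb ->]]]|[f fQ ->]].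
  exists (col_mx (const_mx (- b)) c).
    by move=> z /cb; rewrite ev_col; lra.
  by apply/seteqP; split=> z [Qz /= zb]; split=> //;
    move: zb; rewrite /zeros /= ev_col; lra.
exists (dsubmx f), (- f 0 0); split.
  by move=> z /fQ; rewrite ev_entries; lra.
by apply/seteqP; split=> z [Qz /= zb]; split=> //;
  move: zb; rewrite /zeros /= ev_entries; lra.
Qed.

Lemma face_sub Q F : face Q F -> F `<=` Q.
Proof. by move=> [c [b [_ ->]]] z []. Qed.

Lemma faceI Q F G : face Q F -> face Q G -> face Q (F `&` G).
Proof.
move=> /faceP[f fQ ->] /faceP[g gQ ->]; apply/faceP; exists (f + g).
  by move=> z Qz; rewrite evD; move: (fQ z Qz) (gQ z Qz); lra.
apply/seteqP; split=> z.
  by move=> [[Qz fz] [_ gz]]; split=> //; rewrite /zeros /= evD fz gz addr0.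
move=> [Qz]; rewrite /zeros /= evD => fgz; move: (fQ z Qz) (gQ z Qz) => ? ?.
by split; split => //; rewrite /zeros /=; lra.
Qed.

Lemma face_refl Q : face Q Q.
Proof.
apply/faceP; exists 0; first by move=> z _; rewrite ev0.
by apply/seteqP; split=> [z Qz|z []//]; split=> //; rewrite /zeros /= ev0.
Qed.

Lemma face0 Q : face Q set0.
Proof.
apply/faceP; exists (col_mx (const_mx (-1)) 0).
  by move=> z _; rewrite ev_col mulmx0 mxE; lra.
apply/seteqP; split=> // z [_]; rewrite /zeros /= ev_col mulmx0 mxE; lra.
Qed.

Definition cvx A := forall (a b : V) (t : R),
  0 <= t -> t <= 1 -> A a -> A b -> A (t *: a + (1 - t) *: b).

Lemma convex_setE A : @convex_set R V A <-> cvx A.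
Proof.
split=> [cA a b t t0 t1 Aa Ab|cA a b t /set_mem Aa /set_mem Ab]; last first.
  by apply/mem_set; apply: cA.
have t01 : Itv.spec (Itv.num_sem (R:=R)) (Itv.Real `[0%Z, 1%Z]) t.
  by apply/andP; split; [exact: ger0_real|rewrite /= in_itv /= t0 t1].
exact: set_mem (cA a b (Itv.mk t01) (mem_set Aa) (mem_set Ab)).
Qed.

Lemma hull_cvx A : cvx (hull A).
Proof.
move=> a b t t0 t1 ha hb X [cX AX]; apply: (proj1 (convex_setE X) cX) => //.
  exact: ha.
exact: hb.
Qed.

Lemma sub_hull A : A `<=` hull A.
Proof. exact: sub_gen_smallest. Qed.

Lemma hull_min A X : cvx X -> A `<=` X -> hull A `<=` X.
Proof. by move=> /convex_setE cX AX; exact: smallest_sub. Qed.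

Lemma hullS A B : A `<=` B -> hull A `<=` hull B.
Proof. by move=> AB; apply: hull_min (@hull_cvx B) _ => z /AB; exact: sub_hull. Qed.

Lemma hull_hullU A B : hull (hull A `|` B) = hull (A `|` B).
Proof.
apply/seteqP; split.
  apply: hull_min; first exact: hull_cvx.
  move=> z [|Bz]; last by apply: sub_hull; right.
  by apply: hullS => ?; left.
by apply: hullS => z [?|?]; [left; exact: sub_hull|right].
Qed.

Lemma hull_set0 : hull (set0 : set V) = set0.
Proof. by apply/seteqP; split=> //; exact: hull_min. Qed.

Lemma hull_set1 v : hull [set v] = [set v].
Proof.
apply/seteqP; split; last exact: sub_hull.
apply: hull_min => // a b t _ _ -> ->; rewrite /= -scalerDl addrC subrK.
by rewrite scale1r.
Qed.

Lemma ev_cvx f (a b : V) t :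
  ev f (t *: a + (1 - t) *: b) = t * ev f a + (1 - t) * ev f b.
Proof.
have := @ev_comb f 2 (fun i => if i == 0 then t else 1 - t)
  (fun i => if i == 0 then a else b).
rewrite !big_ord_recl !big_ord0 /= !addr0; apply.
by rewrite addrC subrK.
Qed.

Lemma cvx_valid f : cvx [set z | ev f z <= 0].
Proof.
move=> a b t t0 t1 /= fa fb; rewrite ev_cvx.
have h1 : t * ev f a <= 0 by apply: mulr_ge0_le0.
have h2 : (1 - t) * ev f b <= 0 by apply: mulr_ge0_le0 => //; lra.
lra.
Qed.

Lemma cvx_neg f : cvx [set z | ev f z < 0].
Proof.
move=> a b t t0 t1 /= fa fb; rewrite ev_cvx.
have [->|tn] := eqVneq t 0; first lra.
have h1 : t * ev f a < 0 by rewrite pmulr_rlt0 // lt_neqAle eq_sym tn.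
have h2 : (1 - t) * ev f b <= 0 by apply: mulr_ge0_le0; lra.
lra.
Qed.

Lemma cvx_zeros f : cvx (zeros f).
Proof.
by move=> a b t t0 t1; rewrite /zeros /= ev_cvx => -> ->; rewrite !mulr0 addr0.
Qed.

Lemma valid_hull f A : valid f (hull A) <-> valid f A.
Proof.
split=> [fA z Az|fA]; first by apply: fA; exact: sub_hull.
by have h : hull A `<=` [set z | ev f z <= 0] := hull_min (@cvx_valid f) fA.
Qed.

(** A convex combination of nonpositive values vanishes only if every value of positive weight does.
    Hence the set [X] below, which contains [A], is convex and so contains the hull. *)
Lemma hull_zeros f A : valid f A ->
  hull A `&` zeros f = hull (A `&` zeros f).
Proof.
move=> fA; apply/seteqP; split; last first.
  move=> z h; split; first by apply: hullS h => ? [].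
  suff /(_ z h) : hull (A `&` zeros f) `<=` zeros f by [].
  by apply: hull_min => [|? []//]; exact: cvx_zeros.
pose X := [set z | ev f z <= 0 /\ (ev f z = 0 -> hull (A `&` zeros f) z)].
suff AX : hull A `<=` X by move=> z [/AX [_ h] /h].
apply: hull_min; last first.
  by move=> z Az; split; [exact: fA|move=> fz; exact: sub_hull].
move=> a b t t0 t1 [fa ha] [fb hb]; split; first exact: cvx_valid.
rewrite ev_cvx => e.
have [t00|tn0] := eqVneq t 0.
  by move: e; rewrite t00 subr0 !mul0r add0r !mul1r scale0r add0r scale1r.
have [t11|tn1] := eqVneq t 1.
  by move: e; rewrite t11 subrr !mul0r addr0 !mul1r scale0r addr0 scale1r.
have tp : 0 < t by rewrite lt_neqAle eq_sym tn0.
have tq : 0 < 1 - t by rewrite subr_gt0 lt_neqAle tn1.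
have h1 : t * ev f a <= 0 by rewrite pmulr_rle0.
have h2 : (1 - t) * ev f b <= 0 by rewrite pmulr_rle0.
apply: hull_cvx => //; [apply: ha|apply: hb].
  have /eqP : t * ev f a = 0 by lra.
  by rewrite mulf_eq0 (negbTE tn0) => /eqP.
have /eqP : (1 - t) * ev f b = 0 by lra.
by rewrite mulf_eq0 (gt_eqF tq) => /eqP.
Qed.

Lemma face_hull A F : face (hull A) F -> F = hull (A `&` F).
Proof.
move=> /faceP[f /valid_hull fA ->]; rewrite {1}hull_zeros //; congr hull.
apply/seteqP; split=> z [Az]; last by move=> [_ fz].
by move=> fz; split=> //; split=> //; exact: sub_hull.
Qed.

Lemma face_hull_sub A F X : face (hull A) F -> cvx X ->
  A `&` F `<=` X -> F `<=` X.
Proof. by move=> /face_hull FE cX AFX; rewrite FE; apply: hull_min. Qed.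

Lemma face_cvx A F : face (hull A) F -> cvx F.
Proof. by move=> /face_hull FE; rewrite FE; exact: hull_cvx. Qed.

End AffineFunctionals.

(** * Separation and vertices *)

Section Farkas.
Context {R : realType} {n : nat}.
Implicit Types (T : seq 'rV[R]_n) (z u v a : 'rV[R]_n) (f g : 'cV[R]_n).

Let val f z : R := (z *m f) 0 0.

Fixpoint cone T z : Prop :=
  if T is a :: T' then exists2 l : R, 0 <= l & cone T' (z - l *: a) else z = 0.

Let valB f u v : val f (u - v) = val f u - val f v.
Proof. by rewrite /val mulmxBl !mxE. Qed.

Let valZ f (l : R) u : val f (l *: u) = l * val f u.
Proof. by rewrite /val -scalemxAl !mxE. Qed.

(* Induction on the number of generators: if a functional f separates z from
   cone T but is positive on a, project along a onto the kernel of f. *)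
Lemma farkas T z :
  cone T z \/ exists f, (forall t, t \in T -> val f t <= 0) /\ 0 < val f z.
Proof.
have [k] := ubnP (size T); elim: k T z => // k IH [|a T] z; rewrite /= ?ltnS.
  move=> _; have [->|z0] := eqVneq z 0; [by left|right].
  have [j zj] : exists j, z 0 j != 0.
    apply/existsP; apply: contra_neqT z0 => /existsPn h.
    by apply/rowP => j; rewrite mxE; apply/eqP; move: (h j); rewrite negbK.
  exists (z 0 j *: delta_mx j 0); split=> //.
  rewrite /val -scalemxAr -colE !mxE.
  by rewrite -expr2 lt_neqAle eq_sym sqrf_eq0 zj sqr_ge0.
move=> sT; have [cz|[f [fT fz]]] := IH T z sT.
  by left; exists 0; rewrite // scale0r subr0.
have [fa|fa] := leP (val f a) 0.
  by right; exists f; split=> // t; rewrite inE => /orP[/eqP->|/fT].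
pose pr v := v - (val f v / val f a) *: a.
have fa0 : val f a != 0 by rewrite gt_eqF.
have lift T' u : (forall t, t \in T' -> val f t <= 0) ->
    cone (map pr T') u -> exists v, [/\ cone T' v, u = pr v & val f v <= 0].
  elim: T' u => [|s T' IHT] u fT' /=.
    move=> ->; exists 0; have v0 : val f 0 = 0 by rewrite /val mul0mx mxE.
    by split=> //; rewrite /pr ?v0 // mul0r scale0r subrr.
  case=> l l0 /IHT []; first by move=> t tT; apply: fT'; rewrite inE tT orbT.
  move=> v [cv e fv]; exists (v + l *: s).
  have fvl : val f (v + l *: s) = val f v + l * val f s.
    by rewrite -valZ /val mulmxDl !mxE.
  split; first by exists l => //; rewrite addrK.
    rewrite /pr fvl; apply/eqP; rewrite -subr_eq0; apply/eqP.
    have -> : u = pr v + l *: pr s by rewrite -e subrK.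
    rewrite /pr mulrDl scalerDl scalerBr scalerA mulrA.
    set X := _ *: a; set Y := (l * _ / _) *: a.
    apply/rowP => i; rewrite !mxE; ring.
  rewrite fvl; have := fT' s (mem_head _ _) => fs.
  by have : l * val f s <= 0 by [apply: mulr_ge0_le0]; lra.
have fT' t : t \in T -> val f t <= 0 by move=> tT; apply: fT.
have sT' : (size (map pr T) < k)%N by rewrite size_map.
have [/(lift _ _ fT')[v [cv e fv]]|[g [gT gz]]] := IH (map pr T) (pr z) sT'.
  (* [z] and [v] have the same projection, so they differ by a multiple of [a]; the factor is
     nonnegative because [f] is positive at [z] and at most 0 at [v]. *)
  left; exists ((val f z - val f v) / val f a).
    by rewrite divr_ge0 ?ltW // subr_gt0 (le_lt_trans fv).
  suff -> : z - ((val f z - val f v) / val f a) *: a = v by [].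
  move/rowP : e => e; apply/rowP => i; move: (e i); rewrite /pr !mxE.
  by rewrite mulrBl mulrBl; lra.
(* This is [g] composed with the projection [pr], hence zero at [a]. *)
right; exists (g - (val g a / val f a) *: f).
have E v : val (g - (val g a / val f a) *: f) v = val g (pr v).
  rewrite valB valZ /val mulmxBr -scalemxAr !mxE -!/(val _ _); field.
  by move: fa0; rewrite /val mxE.
split=> [t|]; rewrite E //; rewrite inE => /orP[/eqP->|tT].
  by rewrite /pr divff // scale1r subrr /val mul0mx mxE.
by apply: gT; apply: map_f.
Qed.

End Farkas.

Section Vertices.
Context {R : realType} {d : nat}.
Notation V := 'rV[R]_d.
Implicit Types (T S : seq V) (f g h : 'cV[R]_(1 + d)) (z u v s : V).
Implicit Types (A B Q F X : set V).

(** Dehomogenization: at height 1 the cone over lifted points stays inside any convex set containing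
    the points. The clause for height 0 is carried along because removing one generator may exhaust
    the whole height. *)
Lemma cone_homog X T (m : R) u : cvx X -> (forall t, t \in T -> X t) ->
  cone (map homog T) (row_mx (const_mx m) u) ->
  [/\ 0 <= m, m = 0 -> u = 0 & 0 < m -> X (m^-1 *: u)].
Proof.
move=> cX; elim: T m u => [|a T IH] m u TX /=.
  rewrite -row_mx0 => /eq_row_mx[/matrixP/(_ 0 0)]; rewrite !mxE => -> ->.
  by split; rewrite ?ltxx.
case=> l l0; have -> : row_mx (const_mx m) u - l *: homog a =
    row_mx (const_mx (m - l)) (u - l *: a).
  rewrite /homog scale_row_mx opp_row_mx add_row_mx; congr row_mx.
  by apply/matrixP => i j; rewrite !mxE mulr1.
case/IH=> [t tT|ml H1 H2]; first by apply: TX; rewrite inE tT orbT.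
have Xa : X a by apply: TX; rewrite mem_head.
split; first lra.
  move=> m0; have l00 : l = 0 by lra.
  by move: H1; rewrite m0 l00 subrr scale0r subr0; apply.
move=> mp; have [e|ne] := eqVneq m l.
  have : u - l *: a = 0 by apply: H1; lra.
  by move/eqP; rewrite subr_eq0 => /eqP ->; rewrite -e scalerA mulVf ?gt_eqF // scale1r.
have mlp : 0 < m - l by rewrite lt_neqAle eq_sym subr_eq0 ne.
have := cX a _ (l / m) _ _ Xa (H2 mlp).
have -> : l / m *: a + (1 - l / m) *: ((m - l)^-1 *: (u - l *: a)) = m^-1 *: u.
  have m0 : m != 0 by rewrite gt_eqF.
  have -> : 1 - l / m = (m - l) / m by rewrite mulrBl divff.
  rewrite scalerA mulrAC divff ?gt_eqF // mul1r scalerBr scalerA.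
  by rewrite [m^-1 * l]mulrC addrC subrK.
apply; first by rewrite divr_ge0 // ltW.
by rewrite ler_pdivrMr // mul1r; lra.
Qed.

Lemma separation T z : ~ hull [set` T] z ->
  exists2 f, valid f [set` T] & 0 < ev f z.
Proof.
move=> nz; have [cz|[f [fT fz]]] := farkas (map homog T) (homog z).
  have [] := cone_homog (@hull_cvx _ _ [set` T]) _ cz.
    by move=> t tT; exact: sub_hull.
  by move=> _ _ /(_ ltr01); rewrite invr1 scale1r.
by exists f => // t tT; apply: fT; apply: map_f.
Qed.

(** Generators lying in the hull of the others are discarded. Each remaining one is separated from
    the rest, and shifting the functional to vanish there exposes it as a vertex; a vertex off the
    list would be the hull of no point at all. *)
Lemma polytope_vertices Q : polytope Q ->
  exists S, [/\ uniq S, Q = hull [set` S] & vertices Q = [set` S]].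
Proof.
case=> _ /finite_seqP[S0 ->] ->.
have [S [QE minS]] : exists S, hull [set` S0] = hull [set` S] /\
    forall s, s \in S -> ~ hull [set` [seq t <- S | t != s]] s.
  have [k] := ubnP (size S0); elim: k S0 => // k IH S0; rewrite ltnS => sk.
  have [h|] := pselect (forall s, s \in S0 ->
      ~ hull [set` [seq t <- S0 | t != s]] s); first by exists S0.
  move=> /existsNP[s /not_implyP[sS /contrapT hs]].
  have [|S [E HS]] := IH [seq t <- S0 | t != s].
    apply: leq_trans sk; rewrite size_filter ltn_neqAle count_size andbT.
    by rewrite -all_count; apply/allPn; exists s => //; rewrite eqxx.
  exists S; split=> //; rewrite -E; apply/seteqP; split.
    apply: hull_min; first exact: hull_cvx.
    move=> t /= tS; have [->//|ts] := eqVneq t s.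
    by apply: sub_hull; rewrite /= mem_filter ts.
  by apply: hullS => t /=; rewrite mem_filter => /andP[].
exists (undup S); rewrite undup_uniq QE.
have -> : [set` undup S] = [set` S].
  by apply/seteqP; split=> t; rewrite /= mem_undup.
split=> //; apply/seteqP; split=> v; last first.
  move=> /= vS; have [f fS fv] := separation (minS v vS).
  pose f' := f - ev f v *: col_mx (const_mx 1) 0.
  have E z : ev f' z = ev f z - ev f v.
    by rewrite evD evN evZ ev_col mulmx0 mxE addr0 mulr1.
  have neg t : t \in S -> t != v -> ev f' t < 0.
    move=> tS tv; rewrite E; have := fS t; rewrite /= mem_filter tv tS.
    by move=> /(_ isT); lra.
  apply/faceP; exists f'.
    apply/valid_hull => t tS; have [->|tv] := eqVneq t v; first by rewrite E subrr.
    exact/ltW/neg.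
  have -> : [set v] = hull [set v] by rewrite hull_set1.
  rewrite hull_zeros; last first.
    move=> t tS; have [->|tv] := eqVneq t v; first by rewrite E subrr.
    exact/ltW/neg.
  congr hull; apply/seteqP; split=> t.
    by move=> ->; split=> //; rewrite /zeros /= E subrr.
  move=> [tS]; rewrite /zeros /= => e; apply/eqP; apply: contraT => tv.
  by move: (neg t tS tv); rewrite e ltxx.
move=> /face_hull e; have : [set v] v by [].
rewrite e; apply: contraPP => vS.
suff -> : [set` S] `&` [set v] = set0 by rewrite hull_set0.
by apply/seteqP; split=> t // [tS tv]; apply: vS; rewrite -tv.
Qed.

Lemma vertex_isolated Q v : vertices Q v ->
  exists f, [/\ valid f Q, ev f v = 0 & forall z, Q z -> z <> v -> ev f z < 0].
Proof.
move=> /faceP[f fQ e]; exists f; split=> //.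
  by have : [set v] v by []; rewrite e => -[].
move=> z Qz zv; rewrite lt_neqAle fQ // andbT; apply/eqP => fz.
by apply: zv; have : (Q `&` zeros f) z by []; rewrite -e.
Qed.

Lemma vertex_in Q v : vertices Q v -> Q v.
Proof. by move=> /face_sub; apply. Qed.

Lemma vertex_in_hull Q v A : vertices Q v -> A `<=` Q -> hull A v -> A v.
Proof.
move=> /vertex_isolated[f [_ fv fneg]] AQ; apply: contraPP => Av.
have /[apply] : hull A `<=` [set z | ev f z < 0].
  apply: hull_min; first exact: cvx_neg.
  by move=> z Az; apply: fneg; [exact: AQ|move=> e; apply: Av; rewrite -e].
by rewrite /= fv ltxx.
Qed.

Lemma vertex_of_subset Q F v : vertices Q v -> F `<=` Q -> F v -> vertices F v.
Proof.
move=> /vertex_isolated[f [fQ fv fneg]] FQ Fv; apply/faceP; exists f.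
  by move=> z /FQ; exact: fQ.
apply/seteqP; split=> z; first by move=> ->.
move=> [Fz]; rewrite /zeros /= => e; apply: contrapT => zv.
by have := fneg z (FQ z Fz) zv; rewrite e ltxx.
Qed.

Lemma face_vertex Q F : polytope Q -> face Q F -> F !=set0 ->
  exists2 v, vertices Q v & F v.
Proof.
move=> /polytope_vertices[S [_ QE VE]] fF F0.
have FE : F = hull ([set` S] `&` F) by apply: face_hull; rewrite -QE.
apply: contrapT => h; case: F0 => z; rewrite FE.
suff -> : [set` S] `&` F = set0 by rewrite hull_set0.
apply/seteqP; split=> t // [tS Ft]; apply: h; exists t => //.
by rewrite VE.
Qed.

End Vertices.

(** * Dimension and facets *)

Section Dimension.
Context {R : realType} {d : nat}.
Notation V := 'rV[R]_d.
Implicit Types (f g h : 'cV[R]_(1 + d)) (z u v s : V) (A B Q F X H : set V).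

Lemma row_homog k (p : 'M[R]_(k, d)) i :
  row i (row_mx (const_mx 1 : 'M_(k, 1)) p) = homog (row i p).
Proof. by rewrite row_row_mx /homog row_const. Qed.

Lemma aff_basis A : exists k (p : 'M[R]_(k, d)),
  [/\ pdim A = k%:Z - 1, forall i, A (row i p),
      row_free (row_mx (const_mx 1 : 'M_(k, 1)) p) &
      forall s, A s -> (homog s <= row_mx (const_mx 1 : 'M_(k, 1)) p)%MS].
Proof.
pose indep (k : nat) := exists2 p : 'M[R]_(k, d), forall i, A (row i p) &
  row_free (row_mx (const_mx 1 : 'M[R]_(k, 1)) p).
have [|k0 Pk0 kE] := @eq_bigmax_cond 'I_d.+2 (fun k : 'I_d.+2 => `[< indep k >])
    (fun k => nat_of_ord k).
  apply/card_gt0P; exists ord0; apply/asboolP; exists 0; first by case.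
  by rewrite -row_leq_rank.
have /asboolP[p pA pfree] := Pk0.
exists k0, p; split=> //; first by rewrite /pdim -kE.
move=> s As; apply: contraT => sp; set M := row_mx _ p in pfree sp.
have MsE : row_mx (const_mx 1 : 'M_(k0 + 1, 1)) (col_mx p s) = col_mx M (homog s).
  by rewrite -col_mx_const -block_mxEh block_mxEv.
have rk : \rank M = k0 by apply/eqP.
have lt_rk : (k0 < \rank (col_mx M (homog s)))%N.
  rewrite -{1}rk; apply: rank_ltmx; rewrite ltmxE col_mx_sub submx_refl sp.
  by rewrite -addsmxE addsmxSl.
have le_k : (k0 + 1 < d.+2)%N.
  by rewrite addn1 ltnS; apply: leq_trans lt_rk (rank_leq_col _).
have : indep (k0 + 1)%N.
  exists (col_mx p s).
    move=> i; rewrite -(fintype.splitK i); case: (fintype.split i) => j /=.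
      by rewrite rowKu.
    by rewrite rowKd (ord1 j); have -> : row 0 s = s by apply/rowP => l; rewrite mxE.
  by rewrite MsE -row_leq_rank (leq_trans _ lt_rk) // addn1.
move=> /asboolP ind.
have := @leq_bigmax_cond 'I_d.+2 (fun k : 'I_d.+2 => `[< indep k >])
    (fun k => nat_of_ord k) (Ordinal le_k) ind.
by rewrite kE /= addn1 ltnn.
Qed.

Definition spanning A := forall g, A `<=` zeros g -> g = 0.

(* The affine hull of A is the hyperplane on which h vanishes. *)
Definition hyperplane A h :=
  [/\ h != 0, A `<=` zeros h & forall g, A `<=` zeros g -> exists a, g = a *: h].

Lemma zeros_basis k (p : 'M[R]_(k, d)) A g :
  (forall i, A (row i p)) ->
  (forall s, A s -> (homog s <= row_mx (const_mx 1 : 'M_(k, 1)) p)%MS) ->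
  A `<=` zeros g <-> row_mx (const_mx 1 : 'M_(k, 1)) p *m g = 0.
Proof.
move=> pA Asub; split=> [Ag|pg z /Asub/submxP[D e]].
  apply/row_matrixP => i; rewrite row_mul row_homog row0.
  by apply/matrixP => a b; rewrite !ord1 [RHS]mxE; exact: (Ag _ (pA i)).
by rewrite /zeros /= /ev e -mulmxA pg mulmx0 mxE.
Qed.

Lemma pdim_spanning A : pdim A = d%:Z -> spanning A.
Proof.
have [k [p [-> pA pfree Asub]]] := aff_basis A => kd.
have {}kd : k = (1 + d)%N by lia.
move=> g /(zeros_basis _ pA Asub) pg; move: pfree.
rewrite -row_leq_rank {1}kd col_leq_rank => /row_full_inj; apply.
by rewrite pg mulmx0.
Qed.

(** The functionals vanishing on [A] form a kernel of rank [1 + d - k], where [k] is [pdim A + 1].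
    It contains the line of [h], and equals it exactly when [k = d]. *)
Lemma pdim_hyperplane A h : h != 0 -> A `<=` zeros h ->
  pdim A = d%:Z - 1 <-> hyperplane A h.
Proof.
move=> h0 Ah; have [k [p [-> pA pfree Asub]]] := aff_basis A.
set M := row_mx _ p in pfree Asub; have Mh : M *m h = 0 by apply/(zeros_basis _ pA Asub).
have rk : \rank M = k by apply/eqP.
have rkK : \rank (kermx M^T) = (1 + d - k)%N by rewrite mxrank_ker mxrank_tr rk.
have rkh : \rank h^T = 1%N.
  by apply/eqP; rewrite rank_rV -(trmx0 _ _ _) (inj_eq (@trmx_inj _ _ _)) h0.
have subK g : (g^T <= kermx M^T)%MS <-> A `<=` zeros g.
  rewrite (zeros_basis g pA Asub) -/M; split=> [/sub_kermxP|Mg].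
    by rewrite -trmx_mul => /(congr1 trmx); rewrite trmxK trmx0.
  by apply/sub_kermxP; rewrite -trmx_mul Mg trmx0.
have hK : (h^T <= kermx M^T)%MS by apply/subK.
split=> [kd|[_ _ hyp]].
  split=> // g /subK gK.
  have /andP[_ Kh] : (h^T == kermx M^T)%MS.
    by rewrite -(geq_leqif (mxrank_leqif_eq hK)) rkK rkh; lia.
  have /sub_rVP[a e] := submx_trans gK Kh.
  by exists a; rewrite -[g]trmxK e linearZ /= trmxK.
have Kh : (kermx M^T <= h^T)%MS.
  apply/row_subP => i; rewrite -[row i _]trmxK.
  have [|a ->] := hyp (row i (kermx M^T))^T; last by rewrite linearZ /= scalemx_sub.
  by apply/subK; rewrite trmxK row_sub.
have := mxrankS Kh; have := mxrankS hK; rewrite rkK rkh; lia.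
Qed.

Lemma aff_hyperplane A h : hyperplane A h -> aff A = zeros h.
Proof.
move=> [h0 Ah hyp]; apply/seteqP; split=> [z [n [p [w [pA w1 ->]]]]|z hz].
  rewrite /zeros /= ev_comb // big1 // => i _.
  by rewrite (Ah _ (pA i)) mulr0.
have [k [p [_ pA pfree Asub]]] := aff_basis A; set M := row_mx _ p in pfree Asub.
(* Each column of the cokernel of [M] is a functional vanishing on [A], hence a multiple of [h],
   hence zero at [z]. The first coordinate of the resulting equation says that the weights sum to
   1. *)
have /submxP[D e] : (homog z <= M)%MS.
  rewrite submxE; apply/eqP/rowP => j; rewrite [RHS]mxE.
  have [|a aE] := hyp (col j (cokermx M)).
    by apply/(zeros_basis _ pA Asub); rewrite colE mulmxA mulmx_coker mul0mx.
  by have := evZ a h z; rewrite (hz : ev h z = 0) mulr0 -aE /ev colE mulmxA -colE mxE.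
have e0 : \sum_i D 0 i = 1.
  move/rowP/(_ (lshift _ 0)) : e; rewrite /homog row_mxEl mxE => ->.
  rewrite mxE; apply: eq_bigr => i _; by rewrite /M row_mxEl mxE mulr1.
exists k, (fun i => row i p), (fun i => D 0 i); split=> //.
apply/rowP => j; move/rowP/(_ (rshift _ j)) : e.
rewrite /homog row_mxEr => ->; rewrite mxE summxE; apply: eq_bigr => i _.
by rewrite /M row_mxEr !mxE.
Qed.

(** [g] is a multiple of [h], and the point [v] fixes the sign of the factor. This transfers the
    sign from the unspecified functional in [separated] to a chosen functional of the facet. *)
Lemma hyperplane_sign A h g v z : hyperplane A h -> A `<=` zeros g ->
  ev h v < 0 -> ev g v <= 0 -> 0 < ev g z -> 0 < ev h z.
Proof.
move=> [_ _ hyp] /hyp[a ->]; rewrite !evZ => hv.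
by rewrite nmulr_lle0 // => a0; have [->|an0] := eqVneq a 0;
  rewrite ?mul0r ?ltxx // pmulr_rgt0 // lt_neqAle eq_sym an0.
Qed.

Lemma spanning_neg Q h : spanning Q -> valid h Q -> h != 0 ->
  exists2 v, Q v & ev h v < 0.
Proof.
move=> spQ hQ h0; apply: contrapT => H; case/eqP: h0; apply: spQ => z Qz.
apply/eqP; apply: contraT => hz; case: H; exists z => //.
by rewrite lt_neqAle hz hQ.
Qed.

Lemma facetsP Q F : pdim Q = d%:Z ->
  facets Q F <-> exists h, [/\ valid h Q, F = Q `&` zeros h & hyperplane F h].
Proof.
move=> dQ; have spQ := pdim_spanning dQ; split.
  move=> [/faceP[h hQ FE] dF]; exists h; split=> //; apply/pdim_hyperplane.
  - apply/eqP => h0; suff FQ : F = Q by move: dF; rewrite FQ dQ; lia.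
    by rewrite FE h0; apply/seteqP; split=> z => [[]//|Qz]; split=> //; exact: ev0.
  - by rewrite FE => z [].
  - by rewrite dF dQ.
move=> [h [hQ FE hyp]]; split; first by apply/faceP; exists h.
by rewrite dQ; apply/(@pdim_hyperplane _ h) => //; case: hyp.
Qed.

End Dimension.

(** * Tilting functionals to facets, and their signs at a sewn point *)

Section Facets.
Context {R : realType} {d : nat}.
Notation V := 'rV[R]_d.
Implicit Types (S : seq V) (f g h : 'cV[R]_(1 + d)) (z u v s : V).
Implicit Types (A B Q F H : set V) (C : set (set V)).

Lemma seq_argmin (T : eqType) (r : T -> R) (s : seq T) : s != [::] ->
  exists2 a, a \in s & forall b, b \in s -> r a <= r b.
Proof.
elim: s => // a [|b s] IH _.
  by exists a; rewrite ?mem_head // => c; rewrite inE => /eqP ->.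
have [//|c cs cmin] := IH; have [ac|ca] := leP (r a) (r c).
  exists a; rewrite ?mem_head // => e; rewrite inE => /orP[/eqP->//|/cmin].
  exact: le_trans.
exists c; first by rewrite inE cs orbT.
by move=> e; rewrite inE => /orP[/eqP->|/cmin //]; exact: ltW.
Qed.

(** For perturbing a supporting functional: only its zeros need attention, since a large multiple of
    [f] outweighs [g] at the finitely many other points. *)
Lemma dominate S f g : valid f [set` S] ->
  exists2 N, 0 < N & forall s, s \in S -> ev f s < 0 -> N * ev f s + ev g s < 0.
Proof.
elim: S => [_|a S IH fS]; first by exists 1.
have [|N N0 HN] := IH; first by move=> s sS; apply: fS; rewrite /= inE sS orbT.
have [fa|fa] := ltP (ev f a) 0; last first.
  by exists N => // s; rewrite inE => /orP[/eqP->|/HN//]; rewrite ltNge fa.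
pose c := (`|ev g a| + 1) / - ev f a.
have c0 : 0 < c by rewrite divr_gt0 // ?oppr_gt0 // ltr_wpDl.
exists (N + c); first lra.
move=> s; rewrite inE => /orP[/eqP-> _|sS fs]; last first.
  have := HN s sS fs; have : c * ev f s < 0 by rewrite pmulr_rlt0.
  by rewrite mulrDl; lra.
have : c * ev f a = - (`|ev g a| + 1).
  by rewrite /c invrN mulrN mulNr divfK // lt_eqF.
have : N * ev f a < 0 by rewrite pmulr_rlt0.
by have := ler_norm (ev g a); rewrite mulrDl; lra.
Qed.

(* If the zeros of f do not span a hyperplane, tilt f about them and v until it
   vanishes at a further point of S. *)
Lemma tilt S f v : spanning [set` S] -> valid f [set` S] -> ev f v != 0 ->
  exists h, [/\ valid h [set` S], [set` S] `&` zeros f `<=` zeros h,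
                ev h v = ev f v & hyperplane ([set` S] `&` zeros h) h].
Proof.
move=> spS; have [k] := ubnP (count (fun s => ev f s != 0) S).
elim: k f => // k IH f; rewrite ltnS => ck fS fv.
have f0 : f != 0 by apply: contraNneq fv => ->; rewrite ev0.
have [hyp|nhyp] := pselect (hyperplane ([set` S] `&` zeros f) f).
  by exists f; split=> // z [].
have [g [gz gnf]] : exists g, [set` S] `&` zeros f `<=` zeros g /\
    forall a, g <> a *: f.
  apply: contrapT => H; apply: nhyp; split=> [//|z []//|g gz].
  by apply: contrapT => H'; apply: H; exists g; split=> // a e; apply: H'; exists a.
(* With this correction the direction of tilt vanishes at [v], so the value at [v] survives. *)
pose g1 := g - (ev g v / ev f v) *: f.
have g1z : [set` S] `&` zeros f `<=` zeros g1.
  move=> z zf; rewrite /zeros /= evD evN evZ (gz z zf : ev g z = 0).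
  by case: zf => _; rewrite /zeros /= => ->; rewrite mulr0 subrr.
have g1v : ev g1 v = 0 by rewrite evD evN evZ divfK // subrr.
have [s1 s1S g1s] : exists2 s, s \in S & ev g1 s != 0.
  apply: contrapT => H; apply: (gnf (ev g v / ev f v)); apply/eqP.
  rewrite -subr_eq0; apply/eqP/spS => z zS; apply/eqP; apply: contraT => gz0.
  by case: H; exists z.
have [g2 [g2z g2v g2s]] : exists g2, [/\ [set` S] `&` zeros f `<=` zeros g2,
    ev g2 v = 0 & 0 < ev g2 s1].
  have [g1p|g1n] := leP 0 (ev g1 s1).
    by exists g1; split=> //; rewrite lt_neqAle eq_sym g1s.
  exists (- g1); split; rewrite ?evN ?g1v ?oppr0 ?oppr_gt0 // => z /g1z.
  by rewrite /zeros /= evN => ->; rewrite oppr0.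
have T0 : [seq s <- S | 0 < ev g2 s] != [::].
  by apply/eqP => e; have := mem_filter (fun s => 0 < ev g2 s) s1 S; rewrite e g2s s1S.
(* The ratio is the amount of tilt at which [s] reaches zero; the smallest one gains a new zero
   before validity is lost anywhere. *)
have [s0] := seq_argmin (fun s => - ev f s / ev g2 s) T0.
rewrite mem_filter => /andP[gs0 s0S] s0min; set t := - _ / _ in s0min.
have t0 : 0 <= t.
  by apply: divr_ge0; [rewrite oppr_ge0; exact: (fS s0 s0S)|exact: ltW].
have fE z : ev (f + t *: g2) z = ev f z + t * ev g2 z by rewrite evD evZ.
have fz z : z \in S -> ev f z = 0 -> ev (f + t *: g2) z = 0.
  by move=> zS zf; rewrite fE zf (g2z z (conj zS zf) : ev g2 z = 0) mulr0 addr0.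
have [h [hS hz hv hyp]] : exists h, [/\ valid h [set` S],
    [set` S] `&` zeros (f + t *: g2) `<=` zeros h,
    ev h v = ev (f + t *: g2) v & hyperplane ([set` S] `&` zeros h) h].
  apply: IH.
  - apply: leq_trans ck; rewrite -size_filter.
    rewrite (@eq_in_filter _ _ (predI (fun s => ev (f + t *: g2) s != 0)
                                 (fun s => ev f s != 0))); last first.
      move=> s sS /=; have [zf|] := eqVneq (ev f s) 0; last by rewrite andbT.
      by rewrite fz // eqxx.
    rewrite filter_predI [ltnLHS]size_filter -[ltnRHS]size_filter.
    rewrite ltn_neqAle count_size andbT -all_count.
    apply/allPn; exists s0.
      rewrite mem_filter s0S andbT; apply/eqP => e.
      by move: gs0; rewrite (g2z s0 (conj s0S e) : ev g2 s0 = 0) ltxx.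
    have g0 : ev g2 s0 != 0 by rewrite gt_eqF.
    by rewrite fE /t divfK // subrr eqxx.
  - move=> z zS; rewrite fE; have [gz0|gz0] := ltP 0 (ev g2 z).
      have := s0min z; rewrite mem_filter gz0 (zS : z \in S) => /(_ isT).
      by rewrite ler_pdivlMr //; lra.
    have : t * ev g2 z <= 0 by apply: mulr_ge0_le0.
    by have := fS z zS; lra.
  - by rewrite fE g2v mulr0 addr0.
exists h; split=> //; last by rewrite hv fE g2v mulr0 addr0.
by move=> z [zS zf]; apply: hz; split=> //; exact: fz.
Qed.

Definition facet_functional Q h := valid h Q /\ hyperplane (Q `&` zeros h) h.

Lemma facet_functionalP Q H : pdim Q = d%:Z ->
  facets Q H <-> exists2 h, facet_functional Q h & H = Q `&` zeros h.
Proof.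
move=> dQ; rewrite facetsP //; split=> [[h [hQ HE hyp]]|[h [hQ hyp] HE]].
  by exists h; rewrite // /facet_functional -HE.
by exists h; rewrite {2}HE.
Qed.

Lemma facet_tilt Q f v : polytope Q -> pdim Q = d%:Z -> valid f Q ->
  ev f v != 0 -> exists h, [/\ facet_functional Q h,
    Q `&` zeros f `<=` zeros h & ev h v = ev f v].
Proof.
move=> [_ /finite_seqP[S ->] QE] /pdim_spanning spQ fQ fv; rewrite QE in spQ fQ *.
have spS : spanning [set` S].
  move=> g gS; apply: spQ; apply: hull_min => //; exact: cvx_zeros.
have [h [hS hz hv hyp]] := tilt spS (proj1 (valid_hull _ _) fQ) fv.
exists h; split=> //; last first.
  rewrite hull_zeros; last exact/valid_hull.
  by apply: hull_min => //; exact: cvx_zeros.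
split; first exact/valid_hull.
have [h0 hz' hu] := hyp; split=> [//|z []//|g gz]; apply: hu => z [zS zh].
by apply: gz; split=> //; exact: sub_hull.
Qed.

Lemma facet_avoiding Q F v : polytope Q -> pdim Q = d%:Z -> face Q F ->
  Q v -> ~ F v -> exists H, [/\ facets Q H, F `<=` H & ~ H v].
Proof.
move=> pQ dQ /faceP[f fQ FE] Qv Fv.
have fv : ev f v != 0 by apply/eqP => e; apply: Fv; rewrite FE.
have [h [hQ hz hv]] := facet_tilt pQ dQ fQ fv.
exists (Q `&` zeros h); split.
- by apply/facet_functionalP => //; exists h.
- by rewrite FE => z [Qz fz]; split=> //; apply: hz.
- by move=> [_]; rewrite /zeros /= hv; apply/eqP.
Qed.

Lemma face_neq_facet Q F : polytope Q -> pdim Q = d%:Z -> face Q F ->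
  F <> Q -> exists2 H, facets Q H & F `<=` H.
Proof.
move=> pQ dQ fF FQ; suff [v Qv Fv] : exists2 v, Q v & ~ F v.
  by have [H [? ? ?]] := facet_avoiding pQ dQ fF Qv Fv; exists H.
apply: contrapT => H; apply: FQ; apply/seteqP; split; first exact: face_sub.
by move=> v Qv; apply: contrapT => Fv; apply: H; exists v.
Qed.

Lemma facet_neq Q H : facets Q H -> H <> Q.
Proof. by move=> [_ dH] e; move: dH; rewrite e; lia. Qed.

(** A dimension is invisible to a lattice isomorphism; being a coatom is not. This is how facets
    pass to quotients. *)
Lemma facets_coatomP Q F : polytope Q -> pdim Q = d%:Z ->
  facets Q F <-> [/\ face Q F, F <> Q &
    forall F', face Q F' -> F `<=` F' -> F' = F \/ F' = Q].
Proof.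
move=> pQ dQ; split=> [fF|[fF FQ max]]; last first.
  have [H fH FH] := face_neq_facet pQ dQ fF FQ.
  by have [<-|/(facet_neq fH)] := max H (proj1 fH) FH.
split; [exact: (proj1 fF)|exact: facet_neq|].
move: fF => /facet_functionalP-/(_ dQ)[h [hQ [h0 hz hyp]] FE] F'.
move=> /faceP[g gQ F'E] FF'.
have [|a gE] := hyp g.
  by move=> z hz'; have := FF' z; rewrite FE F'E => /(_ hz')[].
have [a0|a0] := eqVneq a 0; [right|left]; rewrite F'E gE; apply/seteqP.
  by split=> z => [[]//|Qz]; split=> //; rewrite a0 /zeros /= evZ mul0r.
rewrite FE; split=> z [Qz]; rewrite /zeros /= evZ => e; split=> //.
  by move/eqP: e; rewrite mulf_eq0 (negbTE a0) => /eqP.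
by rewrite /= e mulr0.
Qed.

Lemma exactly_beyond_pos Q C z h : pdim Q = d%:Z -> exactly_beyond Q C z ->
  facet_functional Q h -> C (Q `&` zeros h) -> 0 < ev h z.
Proof.
move=> dQ [bey _] [hQ hyp] /bey[_ [c [b [affE cb bz]]]].
pose g := col_mx (const_mx (- b)) c : 'cV[R]_(1 + d).
have gE u : ev g u = (u *m c) 0 0 - b by rewrite ev_col addrC.
have [h0 hz _] := hyp.
have [v Qv hv] := spanning_neg (pdim_spanning dQ) hQ h0.
apply: (@hyperplane_sign _ _ _ h g v z hyp) => //.
- move=> u hu; have : zeros h u by case: hu.
  rewrite -(aff_hyperplane hyp) affE /zeros /= gE => ->; exact: subrr.
- by rewrite gE subr_le0 cb.
- by rewrite gE subr_gt0.
Qed.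

Lemma exactly_beyond_neg Q C z h : pdim Q = d%:Z -> exactly_beyond Q C z ->
  facet_functional Q h -> ~ C (Q `&` zeros h) -> ev h z < 0.
Proof.
move=> dQ [_ ben] [hQ hyp] nC.
have [|naff nsep] := ben (Q `&` zeros h).
  by split=> //; apply/facet_functionalP => //; exists h.
rewrite ltNge; apply/negP; rewrite le_eqVlt => /orP[/eqP e|hz].
  by apply: naff; rewrite (aff_hyperplane hyp).
apply: nsep; exists (dsubmx h), (- h 0 0).
split=> [|u /hQ|]; last 2 first.
- by rewrite ev_entries; lra.
- by move: hz; rewrite ev_entries; lra.
rewrite (aff_hyperplane hyp); apply/seteqP.
by split=> u; rewrite /zeros /= ev_entries => e; lra.
Qed.

(** Tilting at [z] itself preserves the value there, and the sign of a facet functional at [z] tells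
    whether the facet belongs to [C]. *)
Lemma below_facet Q C z f : polytope Q -> pdim Q = d%:Z ->
  exactly_beyond Q C z -> valid f Q -> ev f z < 0 ->
  exists H, [/\ facets Q H, ~ C H & Q `&` zeros f `<=` H].
Proof.
move=> pQ dQ eb fQ fz.
have [h [hQ hz e]] := facet_tilt pQ dQ fQ (negbT (lt_eqF fz)).
exists (Q `&` zeros h); split.
- by apply/facet_functionalP => //; exists h.
- by move=> /(exactly_beyond_pos dQ eb hQ); rewrite e ltNge ltW.
- by move=> u [Qu fu]; split=> //; apply: hz.
Qed.

Lemma above_facet Q C z f : polytope Q -> pdim Q = d%:Z ->
  exactly_beyond Q C z -> valid f Q -> 0 < ev f z ->
  exists H, [/\ facets Q H, C H & Q `&` zeros f `<=` H].
Proof.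
move=> pQ dQ eb fQ fz.
have [h [hQ hz e]] := facet_tilt pQ dQ fQ (negbT (gt_eqF fz)).
exists (Q `&` zeros h); split.
- by apply/facet_functionalP => //; exists h.
- apply: contrapT => /(exactly_beyond_neg dQ eb hQ).
  by rewrite e ltNge ltW.
- by move=> u [Qu fu]; split=> //; apply: hz.
Qed.

(** One tilt gives a facet functional [h], which is nonzero at [z]. For large [N] the functional
    [N *: f - h] is still valid, and as [f] vanishes at [z] its sign there is opposite to that of
    [h]; tilting it gives the facet of the other kind. *)
Lemma tangent_facets Q C z f : polytope Q -> pdim Q = d%:Z ->
  exactly_beyond Q C z -> valid f Q -> ev f z = 0 -> f != 0 ->
  (exists H, [/\ facets Q H, C H & Q `&` zeros f `<=` H]) /\
  (exists H, [/\ facets Q H, ~ C H & Q `&` zeros f `<=` H]).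
Proof.
move=> pQ dQ eb fQ fz f0.
have [v Qv fv] := spanning_neg (pdim_spanning dQ) fQ f0.
have [h [hQ hz _]] := facet_tilt pQ dQ fQ (negbT (lt_eqF fv)).
have fH : facets Q (Q `&` zeros h) by apply/facet_functionalP => //; exists h.
have sub : Q `&` zeros f `<=` Q `&` zeros h.
  by move=> u [Qu fu]; split=> //; apply: hz.
have [g [gQ gz gh]] : exists g, [/\ valid g Q, Q `&` zeros f `<=` zeros g &
    ev g z = - ev h z].
  have [_ /finite_seqP[S ->] QE] := pQ.
  have fS : valid f [set` S] by apply/valid_hull; rewrite -QE.
  have [N N0 HN] := dominate (- h) fS.
  have E u : ev (N *: f - h) u = N * ev f u - ev h u by rewrite evD evZ evN.
  exists (N *: f - h); split.
  - rewrite QE; apply/valid_hull => s sS; rewrite E.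
    have [fs|fs] := ltP (ev f s) 0; first by have := HN s sS fs; rewrite evN => /ltW.
    have fs0 : ev f s = 0 by apply/eqP; rewrite eq_le fs andbT; exact: fS.
    have Qs : Q s by rewrite QE; exact: sub_hull.
    by rewrite fs0 (hz s (conj Qs fs0) : ev h s = 0) mulr0 subrr.
  - by move=> u fu; rewrite /zeros /= E (hz u fu : ev h u = 0)
      (proj2 fu : ev f u = 0) mulr0 subrr.
  - by rewrite E fz mulr0 add0r.
have sub' : Q `&` zeros f `<=` Q `&` zeros g.
  by move=> u fu; split; [case: fu|exact: gz].
have [CH|nCH] := pselect (C (Q `&` zeros h)).
  have hp := exactly_beyond_pos dQ eb hQ CH.
  split; first by exists (Q `&` zeros h).
  have [|H [? ? gH]] := below_facet pQ dQ eb gQ; first by rewrite gh oppr_lt0.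
  by exists H; split=> // u /sub' /gH.
have hn := exactly_beyond_neg dQ eb hQ nCH.
split; last by exists (Q `&` zeros h).
have [|H [? ? gH]] := above_facet pQ dQ eb gQ; first by rewrite gh oppr_gt0.
by exists H; split=> // u /sub' /gH.
Qed.

Lemma zeros_addl Q f h a : valid f Q -> valid h Q -> 0 <= a ->
  Q `&` zeros f `<=` zeros h ->
  valid (f + a *: h) Q /\ Q `&` zeros (f + a *: h) = Q `&` zeros f.
Proof.
move=> fQ hQ a0 fh; have E u : ev (f + a *: h) u = ev f u + a * ev h u.
  by rewrite evD evZ.
have ah u : Q u -> a * ev h u <= 0 by move=> /hQ; exact: mulr_ge0_le0.
split; first by move=> u Qu; rewrite E; move: (fQ u Qu) (ah u Qu); lra.
apply/seteqP; split=> u [Qu]; rewrite /zeros /= E => e; split=> //.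
  by move: (fQ u Qu) (ah u Qu); rewrite /=; lra.
by rewrite /= e (fh u (conj Qu e) : ev h u = 0) mulr0 addr0.
Qed.

(** Adding a multiple of the functional of [H], negative at [z], keeps the face [F]; the factor [a]
    makes the added value [- (|f(z)| + 1)]. *)
Lemma facet_below Q C z F H : polytope Q -> pdim Q = d%:Z ->
  exactly_beyond Q C z -> face Q F -> facets Q H -> ~ C H -> F `<=` H ->
  exists f, [/\ valid f Q, F = Q `&` zeros f & ev f z < 0].
Proof.
move=> pQ dQ eb /faceP[f fQ ->] /facet_functionalP-/(_ dQ)[h hQ ->] nC FH.
have hz := exactly_beyond_neg dQ eb hQ nC.
pose a := (`|ev f z| + 1) / - ev h z.
have a0 : 0 <= a by rewrite divr_ge0 // ?oppr_ge0 ?ltW // addr_ge0.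
have [|v e] := zeros_addl fQ (proj1 hQ) a0; first by move=> u /FH[].
exists (f + a *: h); split=> //; rewrite evD evZ.
have -> : a * ev h z = - (`|ev f z| + 1).
  by rewrite /a invrN mulrN mulNr divfK // lt_eqF.
by have := ler_norm (ev f z); lra.
Qed.

(** Whatever the sign at [z] of a functional of [F], one of the two facets has the opposite sign or
    the value is already 0. A nonnegative multiple of its functional then cancels the value without
    changing the face. *)
Lemma facets_tangent Q C z F H1 H2 : polytope Q -> pdim Q = d%:Z ->
  exactly_beyond Q C z -> face Q F -> facets Q H1 -> C H1 -> F `<=` H1 ->
  facets Q H2 -> ~ C H2 -> F `<=` H2 ->
  exists f, [/\ valid f Q, F = Q `&` zeros f & ev f z = 0].
Proof.
move=> pQ dQ eb /faceP[f fQ ->] /facet_functionalP-/(_ dQ)[h1 h1Q ->] C1 FH1.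
move=> /facet_functionalP-/(_ dQ)[h2 h2Q ->] C2 FH2.
have h1z := exactly_beyond_pos dQ eb h1Q C1.
have h2z := exactly_beyond_neg dQ eb h2Q C2.
have [fz|fz] := leP 0 (ev f z).
  have a0 : 0 <= ev f z / - ev h2 z by rewrite divr_ge0 // oppr_ge0 ltW.
  have [|v e] := zeros_addl fQ (proj1 h2Q) a0; first by move=> u /FH2[].
  exists (f + (ev f z / - ev h2 z) *: h2); split=> //; rewrite evD evZ.
  by rewrite invrN mulrN mulNr divfK ?subrr // lt_eqF.
have a0 : 0 <= - ev f z / ev h1 z by rewrite divr_ge0 // ?oppr_ge0 ltW.
have [|v e] := zeros_addl fQ (proj1 h1Q) a0; first by move=> u /FH1[].
exists (f + (- ev f z / ev h1 z) *: h1); split=> //; rewrite evD evZ.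
by rewrite divfK ?subrr // gt_eqF.
Qed.

End Facets.

(** * Neighbourly polytopes of even dimension are simplicial *)

Lemma card_eq_seq (T : choiceType) (s : seq T) n : uniq s ->
  [set` s] #= `I_n <-> size s = n.
Proof.
move=> us; have -> : [set` s] = [set` [fset x in s]%fset].
  by apply/seteqP; split=> x /=; rewrite inE.
by split=> [/card_eq_fsetP|h]; [|apply/card_eq_fsetP];
  rewrite card_fseq undup_id.
Qed.

Section Simplicial.
Context {R : realType} {d : nat}.
Notation V := 'rV[R]_d.
Implicit Types (S : seq V) (f g h : 'cV[R]_(1 + d)) (z u v s : V).
Implicit Types (A B P Q F H : set V).

Definition hom_mx n (p : 'I_n -> V) : 'M[R]_(n, 1 + d) :=
  \matrix_i homog (p i).

Lemma ev_hom_mx n (p : 'I_n -> V) g i : (hom_mx p *m g) i 0 = ev g (p i).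
Proof.
have -> : (hom_mx p *m g) i 0 = row i (hom_mx p *m g) 0 0 by rewrite [RHS]mxE.
by rewrite row_mul rowK.
Qed.

Definition positive_part n (w : 'rV[R]_n) : {set 'I_n} :=
  [set i | 0 < w 0 i]%SET.

(* Radon's argument: in an affine dependence among the vertices, a face spanned
   by a superset of the vertices with positive coefficients would contain the
   vertices with negative coefficients as well. *)
Lemma radon_positive m P n (p : 'I_n -> V) (w : 'rV[R]_n) :
  neighbourly (2 * m) P -> `I_m.+1 #<= vertices P ->
  injective p -> (forall i, vertices P (p i)) ->
  w != 0 -> w *m hom_mx p = 0 -> (m < #|positive_part w|)%N.
Proof.
move=> [/polytope_vertices[S [uS PE VE]] _ neigh] cV pinj pV w0 wp.
have dep g : \sum_i w 0 i * ev g (p i) = 0.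
  transitivity ((w *m hom_mx p *m g) 0 0); last by rewrite wp mul0mx mxE.
  by rewrite -mulmxA [RHS]mxE; apply: eq_bigr => i _; rewrite ev_hom_mx.
rewrite ltnNge; apply/negP => sA; pose A := positive_part w.
(* Testing the dependence on the constant functional 1 shows that the coefficients sum to 0, so a
   nonzero [w] has a negative entry. *)
have [b wb] : exists b, w 0 b < 0.
  apply: contrapT => H; case/eqP: w0; apply/rowP => i; rewrite mxE.
  have wge j : 0 <= w 0 j by rewrite leNgt; apply/negP => h; apply: H; exists j.
  have := dep (col_mx (const_mx 1) 0).
  under eq_bigr do rewrite ev_col mulmx0 mxE addr0 mulr1.
  move/eqP; rewrite psumr_eq0 // => /allP /(_ i).
  by rewrite mem_index_enum => /(_ isT) /eqP.
pose sA' := [seq p i | i <- enum A].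
pose rest := [seq v <- S | (v \notin sA') && (v != p b)].
have uA : uniq sA' by rewrite map_inj_uniq // enum_uniq.
have bA : p b \notin sA'.
  by rewrite mem_map // mem_enum inE -leNgt ltW.
have uAr : uniq (sA' ++ rest).
  rewrite cat_uniq uA filter_uniq // andbT; apply/hasPn => v.
  by rewrite mem_filter => /andP[/andP[]].
have pS i : p i \in S by have := pV i; rewrite VE.
have sS : (m < size S)%N.
  have := cV; rewrite VE.
  have /card_le_eqr -> : [set` S] #= `I_(size S) by apply/card_eq_seq.
  by rewrite card_le_II.
have sAr : (m <= size (sA' ++ rest))%N.
  have perm : perm_eq (p b :: sA' ++ rest) S.
    apply: uniq_perm => //.
      rewrite /= uAr mem_cat negb_or bA mem_filter eqxx andbF //.
    move=> v; rewrite inE mem_cat mem_filter.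
    have [->|vb] := eqVneq v (p b); first by rewrite pS.
    rewrite /= andbT; have [/mapP[j _ ->]|] := boolP (v \in sA'); first by rewrite pS.
    by [].
  by have := perm_size perm; rewrite /= => e; rewrite -ltnS e.
(* Neighbourliness speaks of exactly [m] vertices, so the positive ones are padded with vertices
   other than [p b]; this requires at least [m + 1] vertices. *)
pose S' := take m (sA' ++ rest).
have uS' : uniq S' by rewrite take_uniq.
have S'V : [set` S'] `<=` vertices P.
  move=> v /= /mem_take; rewrite mem_cat => /orP[/mapP[j _ ->]|]; first exact: pV.
  by rewrite mem_filter VE => /andP[].
have AS' i : 0 < w 0 i -> p i \in S'.
  move=> wi; have : p i \in sA' by rewrite mem_map // mem_enum inE.
  rewrite /S' take_cat size_map -cardE.
  case: ltnP => h; last by rewrite mem_cat => ->.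
  by move: sA; rewrite leqNgt h.
have bS' : p b \notin S'.
  apply/negP => /mem_take; rewrite mem_cat (negbTE bA) mem_filter eqxx.
  by rewrite andbF.
have [||/faceP[f fP fE] _] := neigh [set` S'] => //.
  apply/card_eq_seq => //; rewrite mul2n doubleK size_take.
  by case: ltnP => // h; apply/eqP; rewrite eqn_leq h sAr.
have PS' : [set` S'] `<=` P by move=> v /S'V /vertex_in.
have fb : ev f (p b) < 0.
  rewrite lt_neqAle fP ?andbT; last exact: vertex_in.
  apply/eqP => e; have : hull [set` S'] (p b).
    by rewrite fE; split=> //; exact: vertex_in.
  by move/(vertex_in_hull (pV b) PS'); rewrite /= (negbTE bS').
(* Positive coefficients meet the value 0, the others contribute nonnegative terms, and the term of
   [b] is strictly positive. *)
have := dep f; rewrite (bigD1 b) //=; apply/eqP; rewrite gt_eqF //.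
apply: ltr_wpDr; last by rewrite nmulr_rgt0.
apply: sumr_ge0 => i _; have [wi|wi] := ltP 0 (w 0 i); last first.
  by apply: mulr_le0 => //; apply: fP; exact: vertex_in.
have : hull [set` S'] (p i) by apply: sub_hull; exact: AS'.
by rewrite fE => -[_ e]; rewrite (e : ev f (p i) = 0) mulr0.
Qed.

(** A dependence and its negative each have more than [m] positive coefficients, at disjoint sets of
    indices, so a dependence involves at least [2 * m + 2] vertices. *)
Lemma neighbourly_independent m P n (p : 'I_n -> V) :
  neighbourly (2 * m) P -> `I_m.+1 #<= vertices P ->
  injective p -> (forall i, vertices P (p i)) ->
  (n <= 2 * m + 1)%N -> row_free (hom_mx p).
Proof.
move=> nP cV pinj pV sn; rewrite -kermx_eq0; apply/rowV0P => w /sub_kermxP wp.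
apply/eqP; apply: contraT => w0.
have h1 := radon_positive nP cV pinj pV w0 wp.
have h2 : (m < #|positive_part (- w)|)%N.
  by apply: radon_positive nP cV pinj pV _ _; rewrite ?oppr_eq0 // mulNmx wp oppr0.
suff : (#|positive_part w| + #|positive_part (- w)| <= n)%N by lia.
rewrite -cardsUI.
have -> : (positive_part w :&: positive_part (- w))%SET = finset.set0.
  apply/setP => i; rewrite !inE mxE oppr_gt0.
  by apply/negP => /andP[/ltW wi]; rewrite ltNge wi.
by rewrite cards0 addn0 -[X in (_ <= X)%N]card_ord max_card.
Qed.

(** The vertices on a proper face are affinely independent, so a functional may take arbitrary
    values on them. Adding one that is 0 on [A] and negative on the rest to a large multiple of [f]
    cuts out the hull of [A]. *)
Lemma neighbourly_simplicial m P F A : d = (2 * m)%N ->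
  neighbourly (2 * m) P -> `I_m.+1 #<= vertices P ->
  face P F -> F <> P -> A `<=` vertices P `&` F -> face P (hull A).
Proof.
move=> dE nP cV fF FP AVF; have [pP dP _] := nP.
have [S [uS PE VE]] := polytope_vertices pP.
have /faceP[f fP FE] := fF.
have f0 : f != 0.
  apply/eqP => e; apply: FP; rewrite FE e; apply/seteqP; split=> z => [[]//|Pz].
  by split=> //; exact: ev0.
pose T := [seq v <- S | ev f v == 0].
have uT : uniq T by rewrite filter_uniq.
have TS v : v \in T -> v \in S by rewrite mem_filter => /andP[].
have Tfree : row_free (hom_mx (fun i : 'I_(size T) => T`_i)).
  have inj_nth T' : uniq T' -> injective (fun i : 'I_(size T') => T'`_i).
    by move=> uT' i j /eqP; rewrite nth_uniq // => /eqP/val_inj.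
  have free_T' T' : uniq T' -> (forall v, v \in T' -> v \in S) ->
      (size T' <= 2 * m + 1)%N -> row_free (hom_mx (fun i : 'I_(size T') => T'`_i)).
    move=> uT' T'S sT'; apply: (neighbourly_independent nP cV) => //.
      exact: inj_nth.
    by move=> i; rewrite VE; apply: T'S; rewrite mem_nth.
  (* With more vertices on [F], some [2 * m + 1] of them would be independent and yet lie in the
     kernel of [f], whose rank is [2 * m]. *)
  apply: (free_T') => //; rewrite leqNgt; apply/negP => sT.
  pose T' := take (2 * m + 1) T.
  have sT' : size T' = (2 * m + 1)%N by rewrite size_take sT.
  have := free_T' T' (take_uniq _ uT) (fun v vT => TS v (mem_take vT)).
  rewrite {1}sT' leqnn => /(_ isT).
  rewrite -row_leq_rank {1}sT' => rk.
  have : (hom_mx (fun i : 'I_(size T') => T'`_i) <= kermx f)%MS.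
    apply/sub_kermxP/matrixP => i j; rewrite ord1 ev_hom_mx mxE; apply/eqP.
    have : T'`_i \in T by apply: (@mem_take (2 * m + 1)); rewrite mem_nth.
    by rewrite mem_filter => /andP[].
  move=> /mxrankS; rewrite mxrank_ker.
  have : \rank f = 1%N.
    apply/eqP; rewrite -mxrank_tr rank_rV -(trmx0 _ _ _).
    by rewrite (inj_eq (@trmx_inj _ _ _)) f0.
  by move=> -> h; move: (leq_trans rk h); rewrite dE addKn; lia.
have [N MN] := row_freeP Tfree.
(* [N] is a right inverse, so [g] interpolates the values 0 on [A] and -1 on the other vertices of
   [F]. *)
pose g : 'cV[R]_(1 + d) := N *m \col_i (- (~~ `[< A T`_i >])%:R).
have gE v : v \in T -> ev g v = - (~~ `[< A v >])%:R.
  move=> vT; have := nth_index 0 vT; rewrite -index_mem in vT.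
  move=> {1 2}<-; have := ev_hom_mx (fun i : 'I_(size T) => T`_i) g (Ordinal vT).
  by move=> /= <-; rewrite /g mulmxA MN mul1mx mxE /=.
have fS : valid f [set` S] by apply/valid_hull; rewrite -PE.
have [c c0 Hc] := dominate g fS.
have cE v : ev (c *: f + g) v = c * ev f v + ev g v by rewrite evD evZ.
have cv v : v \in S -> ev (c *: f + g) v <= 0 /\ (ev (c *: f + g) v = 0 <-> A v).
  move=> vS; rewrite cE; have [fv|fv] := ltP (ev f v) 0.
    have h := Hc v vS fv; split; first exact: ltW.
    split=> [e|Av]; first by move: h; rewrite e ltxx.
    have [_] := AVF v Av; rewrite FE => -[_]; rewrite /zeros /= => e.
    by move: fv; rewrite e ltxx.
  have fv0 : ev f v = 0 by apply/eqP; rewrite eq_le fv andbT; exact: fS.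
  have vT : v \in T by rewrite mem_filter fv0 eqxx.
  rewrite fv0 gE // mulr0 add0r; case: asboolP => Av; rewrite ?oppr0.
    by split.
  by split; [rewrite lerN10|split=> // /eqP; rewrite oppr_eq0 oner_eq0].
apply/faceP; exists (c *: f + g).
  by rewrite PE; apply/valid_hull => v /cv[].
rewrite PE hull_zeros; last by move=> v /cv[].
congr hull; apply/seteqP; split=> v.
  move=> Av; have vS : v \in S by have [] := AVF v Av; rewrite VE.
  by split=> //; apply/(proj2 (cv v vS)).
by move=> [vS /(proj2 (cv v vS))].
Qed.

End Simplicial.

(** * Face lattices and quotients *)

Section LatticeIso.
Context {R : realType} {d d' : nat}.
Implicit Types (L : set (set 'rV[R]_d)) (M : set (set 'rV[R]_d')).

Lemma lattice_iso_inj L M f F G : lattice_iso L M f -> L F -> L G ->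
  f F = f G -> F = G.
Proof. by move=> [[_ inj _] _] LF LG e; apply: inj => //; exact: mem_set. Qed.

Lemma lattice_iso_surj L M f F' : lattice_iso L M f -> M F' ->
  exists2 F, L F & f F = F'.
Proof. by move=> [[_ _ surj] _] /surj[F LF <-]; exists F. Qed.

Lemma lattice_iso_fun L M f F : lattice_iso L M f -> L F -> M (f F).
Proof. by move=> [[ff _ _] _] /ff. Qed.

Lemma lattice_iso_bottom L M f A A' : lattice_iso L M f -> L A -> M A' ->
  (forall F, L F -> A `<=` F) -> (forall F, M F -> A' `<=` F) -> f A = A'.
Proof.
move=> iso LA LA' minA minA'; apply/seteqP; split; last first.
  by apply: minA'; apply: lattice_iso_fun iso LA.
have [F LF <-] := lattice_iso_surj iso LA'.
by apply/(proj2 iso _ _ LA LF); exact: minA.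
Qed.

Lemma lattice_iso_top L M f A A' : lattice_iso L M f -> L A -> M A' ->
  (forall F, L F -> F `<=` A) -> (forall F, M F -> F `<=` A') -> f A = A'.
Proof.
move=> iso LA LA' maxA maxA'; apply/seteqP; split.
  by apply: maxA'; apply: lattice_iso_fun iso LA.
have [F LF <-] := lattice_iso_surj iso LA'.
by apply/(proj2 iso _ _ LF LA); exact: maxA.
Qed.

(** By antisymmetry, monotonicity in both directions makes the relation single-valued and injective,
    so any choice of related faces is an isomorphism. *)
Lemma lattice_iso_of_rel L M (rel : set 'rV[R]_d -> set 'rV[R]_d' -> Prop) :
  (forall F, L F -> exists2 F', M F' & rel F F') ->
  (forall F', M F' -> exists2 F, L F & rel F F') ->
  (forall F F' G G', L F -> M F' -> L G -> M G' -> rel F F' -> rel G G' ->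
     (F `<=` G <-> F' `<=` G')) ->
  exists2 f, lattice_iso L M f & forall F, L F -> rel F (f F).
Proof.
move=> tot surj mono.
have /choice[f Hf] : forall F, exists F', L F -> M F' /\ rel F F'.
  move=> F; have [LF|nLF] := pselect (L F); last by exists set0.
  by have [F' ? ?] := tot F LF; exists F'.
have mf F G : L F -> L G -> (F `<=` G <-> f F `<=` f G).
  by move=> LF LG; have [? ?] := Hf F LF; have [? ?] := Hf G LG; apply: mono.
exists f; last by move=> F /Hf[].
split=> //; split; first by move=> F /Hf[].
  move=> F G /set_mem LF /set_mem LG e.
  by apply/seteqP; split; apply/mf => //; rewrite e.
move=> F' LF'; have [F LF rF] := surj F' LF'; have [LfF rfF] := Hf F LF.
exists F => //; apply/seteqP.
by split; apply/(mono F _ F _ LF _ LF _ _ _).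
Qed.

End LatticeIso.

Lemma lattice_iso_comp {R : realType} {d d' d'' : nat}
    (L : set (set 'rV[R]_d)) (M : set (set 'rV[R]_d')) (N : set (set 'rV[R]_d''))
    f g : lattice_iso L M f ->
  lattice_iso M N g -> lattice_iso L N (g \o f).
Proof.
move=> fiso giso; split; last first.
  move=> F G LF LG; rewrite (proj2 fiso _ _ LF LG) (proj2 giso) //;
  exact: lattice_iso_fun fiso _.
split.
- by move=> F LF; exact: (lattice_iso_fun giso (lattice_iso_fun fiso LF)).
- move=> F G /set_mem LF /set_mem LG e; apply: (lattice_iso_inj fiso) => //.
  by apply: (lattice_iso_inj giso _ _ e); exact: (lattice_iso_fun fiso).
- move=> F'' /(lattice_iso_surj giso)[F' /(lattice_iso_surj fiso)[F LF <-] <-].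
  by exists F.
Qed.

Section VertexMap.
Context {R : realType} {d d' : nat}.
Implicit Types (A : set 'rV[R]_d) (B : set 'rV[R]_d').

Lemma lattice_iso_set0 A B f : lattice_iso (face A) (face B) f -> f set0 = set0.
Proof.
by move=> iso; apply: (lattice_iso_bottom iso); first [exact: face0|move=> ? _ ? []].
Qed.

(** Vertices are atoms: the image of [[set v]] contains some vertex [w], and the preimage of
    [[set w]] is a nonempty face inside [[set v]]. *)
Lemma lattice_iso_vertex A B f v : polytope B ->
  lattice_iso (face A) (face B) f -> vertices A v ->
  exists2 w, vertices B w & f [set v] = [set w].
Proof.
move=> pB iso fv; have f0 := lattice_iso_set0 iso.
have ffv := lattice_iso_fun iso fv.
have [|w Bw fw] := face_vertex pB ffv.
  apply/set0P/eqP; rewrite -f0 => /(lattice_iso_inj iso fv (face0 A)) e.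
  by have : [set v] v by []; rewrite e.
exists w => //; have [F fF Fw] := lattice_iso_surj iso Bw.
have Fv : F `<=` [set v] by apply/(proj2 iso _ _ fF fv); rewrite Fw => u ->.
have [u Fu] : F !=set0.
  apply/set0P/eqP => F0; have : [set w] w by [].
  by rewrite -Fw F0 f0.
have <- // : F = [set v].
by apply/seteqP; split=> // u' ->; rewrite -(Fv u Fu).
Qed.

End VertexMap.

Section Quotients.
Context {R : realType} {d d' : nat}.
Implicit Types (Q G F H : set 'rV[R]_d) (v : 'rV[R]_d).

Lemma lattice_iso_vertices A B (f : set 'rV[R]_d -> set 'rV[R]_d') :
  polytope A -> polytope B -> lattice_iso (face A) (face B) f ->
  exists phi, comb_equiv A B phi /\
    forall v, vertices A v -> f [set v] = [set phi v].
Proof.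
move=> pA pB iso.
have /choice[phi Hphi] : forall v, exists w, vertices A v ->
    vertices B w /\ f [set v] = [set w].
  move=> v; have [Av|nAv] := pselect (vertices A v); last by exists 0.
  by have [w ? ?] := lattice_iso_vertex pB iso Av; exists w.
have phiE v : vertices A v -> f [set v] = [set phi v] by move=> /Hphi[].
have bij : set_bij (vertices A) (vertices B) phi.
  split; first by move=> v /Hphi[].
    move=> u v /set_mem Au /set_mem Av e.
    have uv : [set u] = [set v].
      by apply: (lattice_iso_inj iso Au Av); rewrite !phiE // e.
    by have : [set u] u by []; rewrite uv.
  move=> w Bw; have [F fF Fw] := lattice_iso_surj iso Bw.
  have [|v Av Fv] := face_vertex pA fF.
    apply/set0P/eqP => F0; have : [set w] w by [].
    by rewrite -Fw F0 (lattice_iso_set0 iso).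
  exists v => //; have : [set phi v] `<=` f F.
    by rewrite -phiE //; apply/(proj2 iso) => // u ->.
  by rewrite Fw => /(_ _ erefl).
by exists phi; split=> //; split=> //; exists f.
Qed.

Definition atom_above Q G F := [/\ faces_above Q G F, F <> G &
  forall F', faces_above Q G F' -> F' `<=` F -> F' = G \/ F' = F].

(** An atom meets any face through [G] and [v] in a face strictly above [G], hence lies inside it.
    This evaluates [quotient_vertex] without describing the face spanned by [G] and [v]. *)
Lemma face_closure_atom Q G F v : atom_above Q G F -> F v -> ~ G v ->
  face_closure Q (G `|` [set v]) = F.
Proof.
move=> [[fF GF] _ atm] Fv Gv; apply/seteqP; split.
  by move=> z; apply; split=> // u [/GF//|->].
move=> z Fz F' [fF' GF'].
have GF'0 : G `<=` F' by move=> u Gu; apply: GF'; left.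
have F'v : F' v by apply: GF'; right.
have [||e|e] := atm (F `&` F').
- by split; [exact: faceI|move=> u Gu; split; [exact: GF|exact: GF'0]].
- by move=> u [].
- by case: Gv; rewrite -e.
- by move: Fz; rewrite -{1}e => -[].
Qed.

Lemma quotient_bottom Q G (Q' : set 'rV[R]_d') (psi : set 'rV[R]_d -> set 'rV[R]_d') :
  quotient Q G Q' psi -> psi G = set0.
Proof.
move=> [fG _ _ iso]; apply: (lattice_iso_bottom iso).
- by split.
- exact: face0.
- by move=> F [].
- by move=> F _ z.
Qed.

Lemma quotient_top Q G (Q' : set 'rV[R]_d') (psi : set 'rV[R]_d -> set 'rV[R]_d') :
  quotient Q G Q' psi -> psi Q = Q'.
Proof.
move=> [fG _ _ iso]; apply: (lattice_iso_top iso).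
- by split; [exact: face_refl|exact: face_sub].
- exact: face_refl.
- by move=> F [/face_sub].
- by move=> F /face_sub.
Qed.

Lemma quotient_facets Q G (Q' : set 'rV[R]_d') (psi : set 'rV[R]_d -> set 'rV[R]_d') H :
  polytope Q -> pdim Q = d%:Z -> pdim Q' = d'%:Z -> quotient Q G Q' psi ->
  faces_above Q G H -> facets Q H <-> facets Q' (psi H).
Proof.
move=> pQ dQ dQ' quo LH; have psiQ := quotient_top quo.
have [fG pQ' _ iso] := quo.
have LQ : faces_above Q G Q by split; [exact: face_refl|exact: face_sub].
rewrite !facets_coatomP //; split=> [[fH HQ max]|[fH HQ max]].
  split; first exact: (lattice_iso_fun iso LH).
    by rewrite -psiQ => /(lattice_iso_inj iso LH LQ).
  move=> F' /(lattice_iso_surj iso)[F LF <-] /(proj2 iso _ _ LH LF) HF.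
  by have [->|->] := max F (proj1 LF) HF; [left|right].
split; first exact: (proj1 LH).
  by move=> e; apply: HQ; rewrite e.
move=> F fF HF; have LF : faces_above Q G F.
  by split=> // z /(proj2 LH) /HF.
have [||/(lattice_iso_inj iso LF LH)|] := max (psi F).
- exact: (lattice_iso_fun iso LF).
- exact/(proj2 iso).
- by left.
- by rewrite -psiQ => /(lattice_iso_inj iso LF LQ); right.
Qed.

Lemma quotient_atom Q G (Q' : set 'rV[R]_d') (psi : set 'rV[R]_d -> set 'rV[R]_d') F :
  quotient Q G Q' psi -> atom_above Q G F ->
  exists2 w, vertices Q' w & psi F = [set w].
Proof.
move=> quo [LF FG atm]; have psiG := quotient_bottom quo.
have [fG pQ' _ iso] := quo; have LG : faces_above Q G G by split.
have [|w Qw Fw] := face_vertex pQ' (lattice_iso_fun iso LF).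
  by apply/set0P/eqP; rewrite -psiG => /(lattice_iso_inj iso LF LG).
exists w => //; have [F' LF' Fw'] := lattice_iso_surj iso Qw.
have [|e|<- //] := atm F' LF'.
  by apply/(proj2 iso _ _ LF' LF); rewrite Fw' => z ->.
by have : [set w] w by []; rewrite -Fw' e psiG.
Qed.

(* The vertices of Q/G correspond to the atoms above G; each of them picks up a
   vertex of Q off G, and the hypothesis on the numbers of vertices says that
   every vertex off G is picked. *)
Lemma atom_of_vertex Q (T : seq 'rV[R]_d) k n (Q' : set 'rV[R]_d')
    (psi : set 'rV[R]_d -> set 'rV[R]_d') v :
  polytope Q -> uniq T -> size T = k -> [set` T] `<=` vertices Q ->
  quotient Q (hull [set` T]) Q' psi ->
  vertices Q #= `I_(n + k) -> vertices Q' #= `I_n ->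
  vertices Q v -> ~ hull [set` T] v ->
  exists2 F, atom_above Q (hull [set` T]) F & F v.
Proof.
move=> /polytope_vertices[S [uS QE VE]] uT sT TV quo; set G := hull _ in quo *.
have [fG /polytope_vertices[S' [uS' _ VE']] _ iso] := quo.
have psiG := quotient_bottom quo; have LG : faces_above Q G G by split.
rewrite VE VE' => /(card_eq_seq _ uS) sS /(card_eq_seq _ uS') sS' Sv Gv.
have GS u : u \in S -> G u -> u \in T.
  move=> uS1; apply: (@vertex_in_hull _ _ Q); first by rewrite VE.
  by move=> t /TV /vertex_in.
have at_w w : w \in S' -> exists Fu : set 'rV[R]_d * 'rV[R]_d,
    [/\ atom_above Q G Fu.1, psi Fu.1 = [set w], Fu.2 \in S, Fu.1 Fu.2 & ~ G Fu.2].
  move=> wS'; have Qw : vertices Q' w by rewrite VE'.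
  have [F LF Fw] := lattice_iso_surj iso Qw.
  have FG : F <> G.
    by move=> e; have : [set w] w by []; rewrite -Fw e psiG.
  have aF : atom_above Q G F.
    split=> // F' LF' F'F; have : psi F' `<=` [set w].
      by rewrite -Fw; apply/(proj2 iso).
    move=> /subset_set1[e|e]; [left|right].
      by apply: (lattice_iso_inj iso LF' LG); rewrite e psiG.
    by apply: (lattice_iso_inj iso LF' LF); rewrite e.
  have [u uS1 [Fu Gu]] : exists2 u, u \in S & F u /\ ~ G u.
    apply: contrapT => nu; apply: FG; apply/seteqP; split; last exact: (proj2 LF).
    apply: (@face_hull_sub _ _ [set` S]);
      [by rewrite -QE; exact: (proj1 LF)|exact: hull_cvx|].
    by move=> u [uS1 Fu]; apply: contrapT => Gu; apply: nu; exists u.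
  by exists (F, u).
have /choice[a Ha] : forall w, exists Fu : set 'rV[R]_d * 'rV[R]_d, w \in S' ->
    [/\ atom_above Q G Fu.1, psi Fu.1 = [set w], Fu.2 \in S, Fu.1 Fu.2 & ~ G Fu.2].
  move=> w; have [wS'|] := boolP (w \in S'); last by exists (set0, 0).
  by have [Fu ?] := at_w w wS'; exists Fu.
pose W := [seq (a w).2 | w <- S'].
(* An atom is the closure of [G] and any of its vertices off [G], so distinct atoms pick distinct
   vertices. *)
have uW : uniq W.
  rewrite map_inj_in_uniq // => w w' wS wS' e.
  have [aF Fw _ Fu Gu] := Ha w wS; have [aF' Fw' _ Fu' _] := Ha w' wS'.
  have FF' : (a w).1 = (a w').1.
    by rewrite -(face_closure_atom aF Fu Gu) e (face_closure_atom aF' Fu') // -e.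
  by have : [set w] w by []; rewrite -Fw FF' Fw'.
pose S1 := [seq u <- S | u \notin T].
have WS1 : {subset W <= S1}.
  move=> _ /mapP[w wS ->]; have [_ _ uS1 _ Gu] := Ha w wS.
  rewrite mem_filter uS1 andbT; apply/negP => uT1; apply: Gu; exact: sub_hull.
have sS1 : (size S1 <= size W)%N.
  have := count_predC (mem T) S.
  have -> : count (mem T) S = k.
    rewrite -size_filter -sT; apply: perm_size; apply: uniq_perm => //.
      by rewrite filter_uniq.
    move=> u; rewrite mem_filter /=; have [uT1|//] := boolP (u \in T).
    by rewrite andTb; have := TV u uT1; rewrite VE.
  rewrite -size_filter size_map sS sS'.
  by rewrite (@eq_filter _ (predC (mem T)) (fun u => u \notin T)) // -/S1; lia.
have [_ /(_ v)] := uniq_min_size uW WS1 sS1.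
rewrite mem_filter (Sv : v \in S) andbT.
have -> : v \notin T by apply/negP => vT; apply: Gv; exact: sub_hull.
move=> /mapP[w wS e]; have [aF _ _ Fu _] := Ha w wS.
by exists (a w).1; rewrite // e.
Qed.

End Quotients.

(** * Towers and levels of facets *)

Section Towers.
Context {R : realType} {d : nat}.
Notation V := 'rV[R]_d.
Implicit Types (x y : nat -> V) (Q P F H : set V).

Fixpoint Phi_vertices x y j : seq V :=
  if j is k.+1 then x j :: y j :: Phi_vertices x y k else [::].

Lemma PhiE x y j : Phi x y j = hull [set` Phi_vertices x y j].
Proof.
elim: j => [|j IH] /=.
  have -> : [set` [::]] = set0 :> set V by apply/seteqP; split.
  by rewrite hull_set0.
rewrite IH hull_hullU; congr hull; apply/seteqP; split=> v /=.
  by move=> [vP|[->|->]]; rewrite !inE ?vP ?eqxx ?orbT.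
rewrite !inE => /orP[/eqP->|/orP[/eqP->|vP]]; last by left.
  by right; left.
by right; right.
Qed.

Lemma PhiS x y j : Phi x y j.+1 = hull (Phi x y j `|` [set x j.+1; y j.+1]).
Proof. by []. Qed.

Lemma Phi_mono x y j k : (j <= k)%N -> Phi x y j `<=` Phi x y k.
Proof.
move=> /subnK <-; elim: (k - j)%N => // n IH; rewrite addSn PhiS => v /IH Pv.
by apply: sub_hull; left.
Qed.

Lemma mem_Phi_x x y j : Phi x y j.+1 (x j.+1).
Proof. by rewrite PhiS; apply: sub_hull; right; left. Qed.

Lemma mem_Phi_y x y j : Phi x y j.+1 (y j.+1).
Proof. by rewrite PhiS; apply: sub_hull; right; right. Qed.

Lemma mem_Phi_vertices x y j v : reflect
  (exists2 k, (1 <= k <= j)%N & v = x k \/ v = y k) (v \in Phi_vertices x y j).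
Proof.
elim: j => [|j IH] /=; first by constructor=> -[k]; lia.
rewrite !inE; apply: (iffP idP).
  move=> /orP[/eqP->|/orP[/eqP->|/IH[k kj vk]]].
  - by exists j.+1; rewrite ?ltnSn ?leqnn //; left.
  - by exists j.+1; rewrite ?ltnSn ?leqnn //; right.
  - by exists k => //; lia.
move=> [k kj vk]; have [kE|kn] := eqVneq k j.+1.
  by move: vk; rewrite kE => -[->|->]; rewrite eqxx ?orbT.
apply/orP; right; apply/orP; right; apply/IH; exists k => //; lia.
Qed.

Lemma size_Phi_vertices x y j : size (Phi_vertices x y j) = (2 * j)%N.
Proof. by elim: j => //= j ->; lia. Qed.

Lemma universal_towerP P r x y : universal_tower P r x y ->
  [/\ forall j, (j <= r)%N -> uniq (Phi_vertices x y j),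
      forall j, (j <= r)%N -> [set` Phi_vertices x y j] `<=` vertices P &
      forall j, (1 <= j <= r)%N -> universal (2 * j - 1) P (Phi x y j)].
Proof.
move=> [xyV xyu uni]; split=> // [j jr|j jr v /mem_Phi_vertices[k kj]]; last first.
  have [|Vx Vy] := xyV k; first lia.
  by move=> [->|->].
move: xyu; rewrite cat_uniq => /and3P[ux xy0 uy].
have mx k : (1 <= k <= r)%N -> k \in iota 1 r by rewrite mem_iota; lia.
have inj z : uniq [seq z j | j <- iota 1 r] ->
    forall k l, (1 <= k <= r)%N -> (1 <= l <= r)%N -> z k = z l :> V -> k = l.
  move=> uz k l kr lr e; have := uniqP (z 0%N) uz k.-1 l.-1.
  rewrite !inE !size_map !size_iota !(nth_map 0%N) ?size_iota ?nth_iota;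
    try lia.
  move=> H; suff : k.-1 = l.-1 by lia.
  apply: H; try lia.
  by rewrite !add1n !prednK //; lia.
have xyn k l : (1 <= k <= r)%N -> (1 <= l <= r)%N -> x k <> y l.
  move=> kr lr e; move/hasPn: xy0 => /(_ (y l)) /=.
  rewrite map_f ?mx // => /(_ isT); rewrite -e map_f ?mx //.
elim: j jr => // j IH jr /=; rewrite IH ?(ltnW jr) // andbT; apply/andP; split.
  rewrite inE negb_or; apply/andP; split; first by apply/eqP/xyn; lia.
  apply/mem_Phi_vertices => -[k kj [e|e]].
    have jk : j.+1 = k by apply: (inj x) => //; lia.
    lia.
  by apply: (xyn j.+1 k) => //; lia.
apply/mem_Phi_vertices => -[k kj [e|e]].
  by apply: (xyn k j.+1) => //; lia.
have jk : j.+1 = k by apply: (inj y) => //; lia.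
lia.
Qed.

Definition level x y r H : nat := \max_(j < r.+1 | `[< Phi x y j `<=` H >]) j.

Lemma level_le x y r H : (level x y r H <= r)%N.
Proof. by apply/bigmax_leqP => j _; rewrite -ltnS. Qed.

Lemma levelP x y r H j : (j <= r)%N ->
  Phi x y j `<=` H <-> (j <= level x y r H)%N.
Proof.
move=> jr; split=> [PH|jl].
  have jr' : (j < r.+1)%N by [].
  apply: (@leq_bigmax_cond _ _ (fun j : 'I_r.+1 => nat_of_ord j) (Ordinal jr')).
  exact/asboolP.
have [|k /asboolP Pk kE] := @eq_bigmax_cond 'I_r.+1
    (fun j : 'I_r.+1 => `[< Phi x y j `<=` H >]) (fun j => nat_of_ord j).
  by apply/card_gt0P; exists ord0; apply/asboolP.
move=> v Pv; apply: Pk; apply: Phi_mono Pv.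
by rewrite -kE.
Qed.

Lemma level_eq x y r H k : (k <= r)%N -> Phi x y k `<=` H ->
  ((k < r)%N -> ~ Phi x y k.+1 `<=` H) -> level x y r H = k.
Proof.
move=> kr /(levelP _ _ _ kr) kl nk; apply/eqP; rewrite eqn_leq kl andbT.
have [kr'|kr'] := ltnP k r; last exact: leq_trans (level_le _ _ _ _) kr'.
by rewrite leqNgt; apply/negP => /(levelP _ _ _ kr'); exact: nk.
Qed.

(** [H] lies in the [j]-th set exactly when [j <= l], also for [j = 0] and [j > r]. Hence it lies in
    the difference of index [k] exactly when [l = 2 * k + 1]. *)
Lemma sewing_familyP Q r (Psi : nat -> set V) H l : facets Q H -> (l <= r)%N ->
  (forall j, (1 <= j <= r)%N -> Psi j `<=` H <-> (j <= l)%N) ->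
  sewing_family Q r Psi H <-> odd l.
Proof.
move=> fH lr Hl; have thr j : facets_through Q r Psi j H <-> (j <= l)%N.
  rewrite /facets_through; case: eqP => [->//|/eqP j0].
  case: leqP => jr; last by split=> //; lia.
  by split=> [[_ /Hl]|jl]; [apply; lia|split=> //; apply/Hl; lia].
split=> [[k _ [/thr h1 /thr h2]]|ol]; first lia.
exists l./2 => //; split; first by apply/thr; lia.
by move/thr; lia.
Qed.

End Towers.

(** * Faces of a sewn polytope *)

Section Sewn.
Context {R : realType} {d : nat}.
Implicit Types (Q F K : set 'rV[R]_d) (z : 'rV[R]_d) (g : 'cV[R]_(1 + d)).

Lemma face_sewn Q z g : valid g Q -> ev g z <= 0 ->
  let K := hull (Q `|` [set z]) `&` zeros g in
  [/\ face (hull (Q `|` [set z])) K, Q `&` K = Q `&` zeros g &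
      K z <-> ev g z = 0].
Proof.
move=> gQ gz K; split.
- apply/faceP; exists g => //; apply/valid_hull => u [/gQ//|->//].
- apply/seteqP; split=> u [Qu]; first by case.
  by move=> gu; split=> //; split=> //; apply: sub_hull; left.
- by split=> [[]//|e]; split=> //; apply: sub_hull; right.
Qed.

Lemma sewn_faceP Q z K : face (hull (Q `|` [set z])) K ->
  exists g, [/\ valid g Q, ev g z <= 0 & K = hull (Q `|` [set z]) `&` zeros g].
Proof.
move=> /faceP[g /valid_hull gQ KE]; exists g; split=> //.
  by move=> u Qu; apply: gQ; left.
by apply: gQ; right.
Qed.

(** A face is the hull of the generators in it, so its trace on [Q] and its behaviour at [z]
    determine it. *)
Lemma sewn_face_le Q z K K' : face (hull (Q `|` [set z])) K ->
  face (hull (Q `|` [set z])) K' ->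
  K `<=` K' <-> Q `&` K `<=` Q `&` K' /\ (K z -> K' z).
Proof.
move=> fK fK'; split=> [KK'|[QK Kz]].
  by split=> [u [Qu /KK']|/KK'//].
apply: (face_hull_sub fK (face_cvx fK')) => u [[Qu|->] Ku]; last exact: Kz.
by have [] := QK u (conj Qu Ku).
Qed.

End Sewn.

(** * Matching the faces of the two sewn polytopes *)

Section Main.
Context {R : realType} {m : nat} {P : set 'rV[R]_(2 * m)}.
Context {x y : nat -> 'rV[R]_(2 * m)} {xbar : 'rV[R]_(2 * m)}.
Context {Pplus : set 'rV[R]_(2 * m)} {i : nat}.
Context {Q : set 'rV[R]_(2 * (m - i))}.
Context {psi : set 'rV[R]_(2 * m) -> set 'rV[R]_(2 * (m - i))}.
Context {ybar : 'rV[R]_(2 * (m - i))} {Qplus : set 'rV[R]_(2 * (m - i))}.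
Context (nP : neighbourly (2 * m) P) (cV : `I_(2 * m + 3) #<= vertices P).
Context (tow : universal_tower P m x y).
Context (sewP : sewn P m (Phi x y) xbar Pplus) (im : (1 <= i <= m)%N).
Context (quo : quotient P (Phi x y i) Q psi).
Context (sewQ : sewn Q (m - i) (fun j => psi (Phi x y (i + j))) ybar Qplus).
Implicit Types (F H M : set 'rV[R]_(2 * m)) (K : set 'rV[R]_(2 * (m - i))).
Implicit Types (v : 'rV[R]_(2 * m)).

Local Notation lev := (level x y m).
Local Notation G := (hull (Phi x y i.-1 `|` [set x i; xbar])).

Let pP : polytope P. Proof. by case: nP. Qed.
Let dP : pdim P = (2 * m)%N%:Z. Proof. by case: nP. Qed.
Let pQ : polytope Q. Proof. by case: quo. Qed.

Let im' : (i <= m)%N. Proof. by case/andP: im. Qed.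

Let cV' : `I_m.+1 #<= vertices P.
Proof. by apply: card_le_trans cV; rewrite card_le_II; lia. Qed.

Let hullV : P = hull (vertices P).
Proof. by have [S [_ PE VE]] := polytope_vertices pP; rewrite VE. Qed.

Let cvxP F : face P F -> cvx F.
Proof. by rewrite hullV; exact: face_cvx. Qed.

Let PhiV j : (j <= m)%N -> [set` Phi_vertices x y j] `<=` vertices P.
Proof. by have [_ h _] := universal_towerP tow; exact: h. Qed.

Let facePhi j : (j <= m)%N -> face P (Phi x y j).
Proof.
case: j => [_|j jm]; first exact: face0.
by have [_ _ /(_ j.+1)[]] := universal_towerP tow.
Qed.

Let dimPhi j : (1 <= j <= m)%N -> pdim (Phi x y j) = (2 * j - 1)%N%:Z.
Proof. by have [_ _ h /h[]] := universal_towerP tow. Qed.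

Let Phi_neq j : (1 <= j <= m)%N -> Phi x y j <> P.
Proof. by move=> jm e; have := dimPhi jm; rewrite e dP; lia. Qed.

Let mem_Phi j v : (j <= m)%N -> vertices P v -> Phi x y j v ->
  v \in Phi_vertices x y j.
Proof.
move=> jm Vv; rewrite PhiE; apply: (@vertex_in_hull _ _ P) => //.
by move=> u /(PhiV jm)/vertex_in.
Qed.

Let dQ : pdim Q = (2 * (m - i))%N%:Z.
Proof. by have [_ _ -> _] := quo; rewrite dP dimPhi //; lia. Qed.

Let iso : lattice_iso (faces_above P (Phi x y i)) (face Q) psi.
Proof. by case: quo. Qed.

Let simplicial F A : face P F -> F <> P -> A `<=` vertices P `&` F ->
  face P (hull A).
Proof. exact: (neighbourly_simplicial erefl nP). Qed.

Let Phi_vertex j : (1 <= j <= m)%N -> vertices P (x j) /\ vertices P (y j).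
Proof. by have [h _ _] := tow; exact: h. Qed.

Let Phi_lt j : (j < m)%N -> ~ Phi x y j (x j.+1) /\ ~ Phi x y j (y j.+1).
Proof.
move=> jm; have [|xV yV] := @Phi_vertex j.+1; first lia.
have [/(_ j.+1 jm) u _ _] := universal_towerP tow; move: u => /=.
rewrite inE negb_or => /andP[/andP[_ xn] /andP[yn _]].
by split=> h; [case/negP: xn|case/negP: yn]; exact: mem_Phi (ltnW jm) _ h.
Qed.

Let face_vertices F F' : face P F -> face P F' ->
  F `<=` F' <-> (forall v, vertices P v -> F v -> F' v).
Proof.
move=> fF fF'; split=> [FF' v _|FF']; first exact: FF'.
apply: (@face_hull_sub _ _ (vertices P)); first by rewrite -hullV.
  exact: cvxP.
by move=> v [Vv Fv]; exact: FF'.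
Qed.

Let CP H : facets P H -> sewing_family P m (Phi x y) H <-> odd (lev H).
Proof.
move=> fH; apply: sewing_familyP => //; first exact: level_le.
by move=> j jm; apply: levelP; lia.
Qed.

Let above_Phi j : (i <= j <= m)%N -> faces_above P (Phi x y i) (Phi x y j).
Proof. by move=> ij; split; [apply: facePhi; lia|apply: Phi_mono; lia]. Qed.

Let facetQ H : faces_above P (Phi x y i) H -> facets P H <-> facets Q (psi H).
Proof. exact: quotient_facets pP dP dQ quo. Qed.

(** Dividing by Phi_i lowers every level by [i]. So ybar is beneath exactly those facets whose level
    in P has the parity of [i]. *)
Let CQ H : facets P H -> Phi x y i `<=` H ->
  sewing_family Q (m - i) (fun j => psi (Phi x y (i + j))) (psi H) <->
  odd (lev H - i).
Proof.
move=> fH iH; have LH : faces_above P (Phi x y i) H by split=> //; case: fH.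
apply: sewing_familyP; first exact/facetQ.
  by have := level_le x y m H; lia.
move=> j jm; rewrite -(proj2 iso); [|apply: above_Phi; lia|by []].
have il := proj1 (levelP x y H im') iH.
have ijm : (i + j <= m)%N by lia.
by split=> [/(levelP x y H ijm)|jl]; [|apply/(levelP x y H ijm)]; lia.
Qed.

Let level_pred H : Phi x y i.-1 `<=` H -> ~ H (y i) -> lev H = i.-1.
Proof.
move=> iH yH; apply: level_eq => //; first lia.
move=> _ PH; apply: yH; apply: PH; rewrite prednK; last lia.
have -> : i = i.-1.+1 by lia.
exact: mem_Phi_y.
Qed.

(** A facet through Phi_j that misses x_(j+1) has level [j]; for [j = m] any facet through Phi_m
    will do. *)
Let facet_of_level j : (1 <= j <= m)%N ->
  exists H, [/\ facets P H, Phi x y j `<=` H & lev H = j].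
Proof.
move=> jm; have fj : face P (Phi x y j) by apply: facePhi; lia.
have [jm'|mj] := ltnP j m; last first.
  have [H fH jH] := face_neq_facet pP dP fj (Phi_neq jm).
  by exists H; split=> //; apply: level_eq => //; lia.
have [xV _] := @Phi_vertex j.+1 jm'.
have [H [fH jH xH]] := facet_avoiding pP dP fj (vertex_in xV) (proj1 (Phi_lt jm')).
exists H; split=> //; apply: level_eq => // [|_ h]; first lia.
by apply: xH; apply: h; exact: mem_Phi_x.
Qed.

Let PplusE : Pplus = hull (P `|` [set xbar]). Proof. by case: sewP. Qed.
Let QplusE : Qplus = hull (Q `|` [set ybar]). Proof. by case: sewQ. Qed.

Let tangentP F H1 H2 : face P F -> facets P H1 -> F `<=` H1 -> facets P H2 ->
  F `<=` H2 -> odd (lev H1) != odd (lev H2) ->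
  exists M, [/\ face Pplus M, P `&` M = F & M xbar].
Proof.
wlog odd1 : H1 H2 / odd (lev H1).
  move=> W fF f1 F1 f2 F2 ne; case o1 : (odd (lev H1)).
    by apply: (W H1 H2).
  apply: (W H2 H1) => //; last by rewrite eq_sym.
  by move: ne; rewrite o1; case: odd.
move=> fF f1 F1 f2 F2; rewrite odd1; case ev2 : (odd (lev H2)) => // _.
have nC2 : ~ sewing_family P m (Phi x y) H2 by move/(CP f2); rewrite ev2.
have [f [fP FE fx]] := facets_tangent pP dP (proj1 sewP) fF f1
  (proj2 (CP f1) odd1) F1 f2 nC2 F2.
have fx0 : ev f xbar <= 0 by rewrite fx.
have [fM PM Mx] := face_sewn fP fx0.
rewrite PplusE; exists (hull (P `|` [set xbar]) `&` zeros f); split=> //.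
  by rewrite PM.
exact/Mx.
Qed.

Let P_tangent M : face Pplus M -> M xbar -> M <> Pplus ->
  face P (P `&` M) /\ forall b, exists H,
    [/\ facets P H, P `&` M `<=` H & odd (lev H) = b].
Proof.
rewrite PplusE => /sewn_faceP[g [gP gx ME]] Mx MP.
have [fM PM Mxg] := face_sewn gP gx; rewrite ME PM.
split; first by apply/faceP; exists g.
have g0 : g != 0.
  apply/eqP => g0; apply: MP; rewrite ME g0; apply/seteqP.
  by split=> z => [[]//|zP]; split=> //; exact: ev0.
have gx0 : ev g xbar = 0 by apply/Mxg; rewrite -ME.
have [[H1 [f1 C1 F1]] [H2 [f2 C2 F2]]] :=
  tangent_facets pP dP (proj1 sewP) gP gx0 g0.
case; first by exists H1; split=> //; apply/CP.
by exists H2; split=> //; apply/negP => /(CP f2).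
Qed.

Let psi_facet F H : faces_above P (Phi x y i) F -> facets P H -> F `<=` H ->
  [/\ faces_above P (Phi x y i) H, facets Q (psi H), psi F `<=` psi H &
      (i <= lev H)%N].
Proof.
move=> LF fH FH; have iH : Phi x y i `<=` H by move=> v /(proj2 LF)/FH.
have LH : faces_above P (Phi x y i) H by split=> //; case: fH.
split=> //; [exact/(facetQ LH)|exact/(proj2 iso)|exact/(levelP x y H im')].
Qed.

Let tangentQ F H1 H2 : faces_above P (Phi x y i) F -> facets P H1 -> F `<=` H1 ->
  facets P H2 -> F `<=` H2 -> odd (lev H1) != odd (lev H2) ->
  exists K, [/\ face Qplus K, Q `&` K = psi F & K ybar].
Proof.
wlog odd1 : H1 H2 / odd (lev H1 - i).
  move=> W LF f1 F1 f2 F2 ne; case o1 : (odd (lev H1 - i)).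
    by apply: (W H1 H2).
  have [_ _ _ i1] := psi_facet LF f1 F1; have [_ _ _ i2] := psi_facet LF f2 F2.
  by apply: (W H2 H1) => //; lia.
move=> LF f1 F1 f2 F2 ne.
have [L1 fQ1 FQ1 i1] := psi_facet LF f1 F1; have [L2 fQ2 FQ2 i2] := psi_facet LF f2 F2.
have C1 := proj2 (CQ f1 (proj2 L1)) odd1.
have nC2 : ~ sewing_family Q (m - i) (fun j => psi (Phi x y (i + j))) (psi H2).
  by move/(CQ f2 (proj2 L2)); lia.
have [f [fQ FE fy]] := facets_tangent pQ dQ (proj1 sewQ)
  (lattice_iso_fun iso LF) fQ1 C1 FQ1 fQ2 nC2 FQ2.
have fy0 : ev f ybar <= 0 by rewrite fy.
have [fK QK Ky] := face_sewn fQ fy0.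
rewrite QplusE; exists (hull (Q `|` [set ybar]) `&` zeros f); split=> //.
  by rewrite QK.
exact/Ky.
Qed.

Let belowQ F H : faces_above P (Phi x y i) F -> facets P H -> F `<=` H ->
  odd (lev H) = odd i ->
  exists K, [/\ face Qplus K, Q `&` K = psi F & ~ K ybar].
Proof.
move=> LF fH FH oH; have [LH fQH FQH iH] := psi_facet LF fH FH.
have nC : ~ sewing_family Q (m - i) (fun j => psi (Phi x y (i + j))) (psi H).
  by move/(CQ fH (proj2 LH)); lia.
have [f [fQ FE fy]] := facet_below pQ dQ (proj1 sewQ)
  (lattice_iso_fun iso LF) fQH nC FQH.
have [fK QK Ky] := face_sewn fQ (ltW fy).
rewrite QplusE; exists (hull (Q `|` [set ybar]) `&` zeros f); split=> //.
  by rewrite QK.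
by move/Ky => e; move: fy; rewrite e ltxx.
Qed.

Let facet_over_psi (F : set 'rV[R]_(2 * m)) K' : faces_above P (Phi x y i) F ->
  facets Q K' -> psi F `<=` K' -> exists H, [/\ facets P H, F `<=` H & psi H = K'].
Proof.
move=> LF fK' FK'; have [H LH HK'] := lattice_iso_surj iso (proj1 fK').
exists H; split=> //; first by apply/(facetQ LH); rewrite HK'.
by apply/(proj2 iso _ _ LF LH); rewrite HK'.
Qed.

(** Converse to [tangentQ] and [belowQ]. A functional cutting out [K] is zero or negative at ybar;
    either way it tilts to facets of Q, which come from facets of P above [F]. *)
Let Q_face K F : face Qplus K -> K <> Qplus -> faces_above P (Phi x y i) F ->
  psi F = Q `&` K ->
  (K ybar /\ forall b, exists H, [/\ facets P H, F `<=` H & odd (lev H) = b]) \/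
  (~ K ybar /\ exists H, [/\ facets P H, F `<=` H & odd (lev H) = odd i]).
Proof.
rewrite QplusE => /sewn_faceP[g [gQ gy KE]] KQ LF FE.
have [fK QK Kyg] := face_sewn gQ gy.
have FgE : psi F = Q `&` zeros g by rewrite FE KE QK.
have g0 : g != 0.
  apply/eqP => g0; apply: KQ; rewrite KE g0; apply/seteqP.
  by split=> z => [[]//|zP]; split=> //; exact: ev0.
have over K' : facets Q K' -> Q `&` zeros g `<=` K' ->
    exists H, [/\ facets P H, F `<=` H, (i <= lev H)%N &
      sewing_family Q (m - i) (fun j => psi (Phi x y (i + j))) K' <->
      odd (lev H - i)].
  move=> fK' gK'; have [|H [fH FH <-]] := facet_over_psi LF fK'; first by rewrite FgE.
  have [[_ iH] _ _ il] := psi_facet LF fH FH.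
  by exists H; split=> //; exact: CQ.
move: gy; rewrite le_eqVlt => /orP[/eqP gy|gy]; [left|right].
  split; first by rewrite KE; apply/Kyg.
  have [[K1 [k1 C1 gK1]] [K2 [k2 C2 gK2]]] :=
    tangent_facets pQ dQ (proj1 sewQ) gQ gy g0.
  have [H1 [f1 F1 i1 /proj1/(_ C1) o1]] := over K1 k1 gK1.
  have [H2 [f2 F2 i2 /proj2 o2]] := over K2 k2 gK2.
  have {}o2 : odd (lev H2 - i) = false by apply/negP => /o2.
  move=> b; have [e|ne] := eqVneq (odd (lev H1)) b; first by exists H1.
  by exists H2; split=> //; lia.
have [K1 [k1 C1 gK1]] := below_facet pQ dQ (proj1 sewQ) gQ gy.
have [H1 [f1 F1 i1 /proj2 o1]] := over K1 k1 gK1.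
have {}o1 : odd (lev H1 - i) = false by apply/negP => /o1.
split; last by exists H1; split=> //; lia.
by rewrite KE => /Kyg e; move: gy; rewrite e ltxx.
Qed.

(* A face K of Q+ is recorded by the face F of P with F* = K & Q and by whether
   ybar lies in K; the corresponding face M of P+ contains y_i iff K contains
   ybar, and agrees with F on the other vertices of P. *)
Definition sewn_rel K M := exists F,
  [/\ faces_above P (Phi x y i) F, psi F = Q `&` K,
      forall v, vertices P v -> v <> y i -> (M v <-> F v),
      M xbar & M (y i) <-> K ybar].

Let yi : vertices P (y i). Proof. by case: (Phi_vertex im). Qed.
Let xi : vertices P (x i). Proof. by case: (Phi_vertex im). Qed.
Let predi : i = i.-1.+1. Proof. by rewrite prednK //; case/andP: im. Qed.
Let xi_neq : x i <> y i.
Proof.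
have [/(_ i im') u _ _] := universal_towerP tow; move: u; rewrite predi /=.
by rewrite inE negb_or => /andP[/andP[/eqP]].
Qed.
Let yi_pred : ~ Phi x y i.-1 (y i).
Proof. by have [|_] := @Phi_lt i.-1; [lia|rewrite -predi]. Qed.
Let xi_in : Phi x y i (x i). Proof. by rewrite predi; exact: mem_Phi_x. Qed.
Let yi_in : Phi x y i (y i). Proof. by rewrite predi; exact: mem_Phi_y. Qed.
Let PhiSi : Phi_vertices x y i = x i :: y i :: Phi_vertices x y i.-1.
Proof. by rewrite {1}predi /= -predi. Qed.

Let Pplus_cvx M : face Pplus M -> cvx M.
Proof. by rewrite PplusE; exact: face_cvx. Qed.

Let rel_G_sub K M : sewn_rel K M -> face Pplus M -> G `<=` M.
Proof.
move=> [F [[fF iF] FK MF Mx My]] fM; have cM := Pplus_cvx fM.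
rewrite PhiE hull_hullU; apply: hull_min => // v [vi|[->|->//]]; last first.
  by apply/(MF _ xi xi_neq); exact: iF.
have Vv : vertices P v by apply: (PhiV _ vi); lia.
have Pv : Phi x y i.-1 v by rewrite PhiE; exact: sub_hull.
apply/MF => //; first by move=> e; apply: yi_pred; rewrite -e.
by apply: iF; apply: Phi_mono Pv; lia.
Qed.

(* F without y_i lies in H and, by simpliciality, in a facet of level i - 1;
   these have different parities. *)
Let face_del_y F H : face P F -> Phi x y i `<=` F -> facets P H -> F `<=` H ->
  odd (lev H) = odd i -> exists M,
  [/\ face Pplus M, forall v, vertices P v -> v <> y i -> (M v <-> F v),
      M xbar & ~ M (y i)].
Proof.
move=> fF iF fH FH oH; pose A := [set v | [/\ vertices P v, F v & v <> y i]].
have FP : F <> P.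
  move=> e; apply: (facet_neq fH); apply/seteqP; split; first exact: face_sub (proj1 fH).
  by rewrite -e.
have fA : face P (hull A) by apply: simplicial fF FP _ => v [].
have AP : A `<=` P by move=> v [/vertex_in].
have hA v : vertices P v -> hull A v -> A v by move=> Vv; exact: vertex_in_hull Vv AP.
have yA : ~ hull A (y i) by move=> /(hA _ yi)[].
have [H1 [f1 F1 y1]] := facet_avoiding pP dP fA (vertex_in yi) yA.
have i1 : Phi x y i.-1 `<=` H1.
  rewrite PhiE; apply: hull_min.
    exact: cvxP (proj1 f1).
  move=> v vi; have Vv : vertices P v by apply: (PhiV _ vi); lia.
  have Pv : Phi x y i.-1 v by rewrite PhiE; exact: sub_hull.
  apply: F1; apply: sub_hull; split=> //; last by move=> e; apply: yi_pred; rewrite -e.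
  by apply: iF; apply: Phi_mono Pv; lia.
have l1 := level_pred i1 y1.
have AH : hull A `<=` H.
  by move=> v; apply: (hull_min _ _) => [|u [_ /FH]//];
    exact: cvxP (proj1 fH).
have [|M [fM PM Mx]] := tangentP fA fH AH f1 F1; first lia.
have ME v : vertices P v -> M v <-> hull A v.
  by move=> Vv; rewrite -PM; split=> [?|[]//]; split=> //; exact: vertex_in.
exists M; split=> // [v Vv vy|]; last by move=> /(ME _ yi).
rewrite ME //; split=> [/(hA _ Vv)[]//|Fv]; exact: sub_hull.
Qed.

Let Pplus_vertex v : vertices P v -> Pplus v.
Proof. by move=> Vv; rewrite PplusE; apply: sub_hull; left; exact: vertex_in. Qed.

Let Pplus_xbar : Pplus xbar.
Proof. by rewrite PplusE; apply: sub_hull; right. Qed.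

Let Qplus_ybar : Qplus ybar.
Proof. by rewrite QplusE; apply: sub_hull; right. Qed.

Let QQplus : Q `&` Qplus = Q.
Proof.
apply/seteqP; split=> z; first by case.
by move=> Qz; split=> //; rewrite QplusE; apply: sub_hull; left.
Qed.

Let rel_top : sewn_rel Qplus Pplus.
Proof.
exists P; split.
- by split; [exact: face_refl|apply: face_sub; exact: facePhi].
- by rewrite (quotient_top quo) QQplus.
- by move=> v Vv _; split=> _; [exact: vertex_in|exact: Pplus_vertex].
- exact: Pplus_xbar.
- by split=> _; [exact: Qplus_ybar|exact: Pplus_vertex].
Qed.

Let rel_total K : face Qplus K -> exists2 M, faces_above Pplus G M & sewn_rel K M.
Proof.
move=> fK; suff [M fM rM] : exists2 M, face Pplus M & sewn_rel K M.
  by exists M => //; split=> //; exact: rel_G_sub rM fM.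
have [->|KQ] := pselect (K = Qplus).
  by exists Pplus; [exact: face_refl|exact: rel_top].
have fQK : face Q (Q `&` K).
  move: fK; rewrite QplusE => /sewn_faceP[g [gQ gy ->]].
  by have [_ -> _] := face_sewn gQ gy; apply/faceP; exists g.
have [F LF FE] := lattice_iso_surj iso fQK.
have [[Ky HH]|[Ky [H [fH FH oH]]]] := Q_face fK KQ LF FE.
  have [H1 [f1 F1 o1]] := HH true; have [H2 [f2 F2 o2]] := HH false.
  have [|M [fM PM Mx]] := tangentP (proj1 LF) f1 F1 f2 F2; first by rewrite o1 o2.
  have ME v : vertices P v -> M v <-> F v.
    by move=> Vv; rewrite -PM; split=> [?|[]//]; split=> //; exact: vertex_in.
  exists M => //; exists F; split=> // [v Vv _|]; first exact: ME.
  by split=> _ //; apply/ME => //; exact: (proj2 LF).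
have [M [fM MF Mx My]] := face_del_y (proj1 LF) (proj2 LF) fH FH oH.
by exists M => //; exists F; split.
Qed.

Let rel_surj M : faces_above Pplus G M -> exists2 K, face Qplus K & sewn_rel K M.
Proof.
move=> [fM GM]; have Mx : M xbar by apply: GM; apply: sub_hull; right; right.
have [->|MP] := pselect (M = Pplus).
  by exists Qplus; [exact: face_refl|exact: rel_top].
have [fPM HH] := P_tangent fM Mx MP.
have MV v : vertices P v -> M v <-> (P `&` M) v.
  by move=> Vv; split=> [?|[]//]; split=> //; exact: vertex_in.
have iM : Phi x y i.-1 `<=` M by move=> v Pv; apply: GM; apply: sub_hull; left.
have xM : M (x i) by apply: GM; apply: sub_hull; right; left.
have [My|My] := pselect (M (y i)).
  have LF : faces_above P (Phi x y i) (P `&` M).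
    split=> //; rewrite PhiE; apply: hull_min.
      exact: cvxP.
    move=> v vi; have Vv := PhiV im' vi; apply/(MV v Vv).
    move: vi; rewrite /= PhiSi !inE => /orP[/eqP->//|/orP[/eqP->//|vi]].
    by apply: iM; rewrite PhiE; exact: sub_hull.
  have [H1 [f1 F1 o1]] := HH true; have [H2 [f2 F2 o2]] := HH false.
  have [|K [fK QK Ky]] := tangentQ LF f1 F1 f2 F2; first by rewrite o1 o2.
  exists K => //; exists (P `&` M); split=> // v Vv _; exact: MV.
have [H [fH FH oH]] := HH (odd i).
have PMi v : Phi x y i.-1 v -> (P `&` M) v.
  move=> Pv; split; last exact: iM.
  exact: (face_sub (facePhi (leq_trans (leq_pred i) im'))).
(* The level of [H] is at least [i - 1], and equality is excluded by its parity. *)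
have iH : Phi x y i `<=` H.
  apply/(levelP x y H im'); have l1 : (i.-1 <= lev H)%N.
    by apply/(levelP x y H); [lia|move=> v /PMi/FH].
  by move: predi; lia.
pose A := [set v | vertices P v /\ ((P `&` M) v \/ v = y i)].
have fF : face P (hull A).
  apply: (simplicial (proj1 fH) (facet_neq fH)) => v [Vv [Mv|->]]; split=> //.
    exact: FH.
  exact: iH.
have AP : A `<=` P by move=> v [/vertex_in].
have hA v : vertices P v -> hull A v -> A v by move=> Vv; exact: vertex_in_hull Vv AP.
have FHA : hull A `<=` H.
  apply: hull_min.
    exact: cvxP (proj1 fH).
  by move=> v [_ [/FH//|->]]; exact: iH.
have LF : faces_above P (Phi x y i) (hull A).
  split=> //; rewrite PhiE; apply: hullS => v vi; have Vv := PhiV im' vi; split=> //.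
  move: vi; rewrite /= PhiSi !inE => /orP[/eqP->|/orP[/eqP->|vi]]; [left|by right|left].
    exact/MV.
  by apply: PMi; rewrite PhiE; exact: sub_hull.
have [K [fK QK Ky]] := belowQ LF fH FHA oH.
exists K => //; exists (hull A); split=> // v Vv vy; rewrite MV //.
split=> [Mv|/(hA _ Vv)[_ []]//]; by apply: sub_hull; split=> //; left.
Qed.

(** Both inclusions are tested on generators. Vertices other than y_i are common to [F] and [M]; y_i
    lies in both [F] and [F'], xbar in both [M] and [M'], and y_i in [M] matches ybar in [K]. *)
Let rel_mono K M K' M' : face Qplus K -> faces_above Pplus G M ->
  face Qplus K' -> faces_above Pplus G M' -> sewn_rel K M -> sewn_rel K' M' ->
  (K `<=` K' <-> M `<=` M').
Proof.
move=> fK [fM _] fK' [fM' _] [F [LF FE MF Mx My]] [F' [LF' FE' MF' Mx' My']].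
move: fK fK' fM fM'; rewrite QplusE PplusE => fK fK' fM fM'.
rewrite (sewn_face_le fK fK') -FE -FE' -(proj2 iso _ _ LF LF').
rewrite (face_vertices (proj1 LF) (proj1 LF')) -My -My'.
split=> [[FF' Myy]|MM']; last first.
  split=> [v Vv Fv|]; last exact: MM'.
  have [->|/eqP vy] := eqVneq v (y i); first exact: (proj2 LF').
  by apply/MF' => //; apply: MM'; apply/MF.
apply: (@face_hull_sub _ _ (vertices P `|` [set xbar])).
- by rewrite -hull_hullU -hullV.
- exact: face_cvx fM'.
move=> v [[Vv|->] Mv //]; have [vE|/eqP vy] := eqVneq v (y i).
  by rewrite vE; apply: Myy; rewrite -vE.
by apply/MF' => //; apply: FF' => //; apply/MF.
Qed.

Let pQplus : polytope Qplus.
Proof.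
have [S fS QE] := pQ; exists (S `|` [set ybar]); first by rewrite finite_setU.
by rewrite QplusE QE hull_hullU.
Qed.

(** The empty face forces [F] to be Phi_i, and deleting y_i while adding xbar leaves the generators
    of [G]. That [G] is a face of P+ follows from this. *)
Let rel_bottom M : faces_above Pplus G M -> sewn_rel set0 M -> M = G.
Proof.
move=> [fM GM] [F [LF FE MF _ My]]; apply/seteqP; split=> //.
have {}FE : F = Phi x y i.
  apply: (lattice_iso_inj iso LF); first by split=> //; exact: facePhi.
  by rewrite FE setI0 (quotient_bottom quo).
move: fM; rewrite PplusE => fM.
apply: (@face_hull_sub _ _ (vertices P `|` [set xbar])).
- by rewrite -hull_hullU -hullV.
- exact: hull_cvx.
move=> v [[Vv|-> _] Mv]; last by apply: sub_hull; right; right.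
have [vE|/eqP vy] := eqVneq v (y i); first by move: Mv; rewrite vE => /My.
have : F v by apply/MF.
rewrite FE => /(mem_Phi im' Vv); rewrite PhiSi !inE => /orP[/eqP->|/orP[/eqP//|vi]].
  by apply: sub_hull; right; left.
by apply: sub_hull; left; rewrite PhiE; exact: sub_hull.
Qed.

(** * The bottom face, atoms, and the bijection of vertices *)

Lemma face_sewn_tower : face Pplus G.
Proof.
have [M LM rM] := rel_total (face0 Qplus).
by rewrite -(rel_bottom LM rM); case: LM.
Qed.

(** Universality is used here through its vertex count. Being an atom refers to P alone, so the
    realization of the quotient supplied by universality may differ from [Q]. If Phi_i is a facet,
    the atom is P itself. *)
Let atom_over v : vertices P v -> ~ Phi x y i v ->
  exists2 F, atom_above P (Phi x y i) F & F v.
Proof.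
move=> Vv iv; have [uT TV /(_ i im)[_ _ uni]] := universal_towerP tow.
have [fi|[e [k' [n [Q' [psi' [quo' _ sP sQ']]]]]]] := uni.
  move: (fi) => /(facets_coatomP _ pP dP)[fPi iP max]; exists P; last exact: vertex_in.
  split; [split|by move=> e; apply: iP|].
  - exact: face_refl.
  - exact: face_sub.
  - by move=> F [fF iF] _; exact: max.
have := @atom_of_vertex _ _ _ P (Phi_vertices x y i) (2 * i)%N n Q' psi' v pP
  (uT i im') (size_Phi_vertices _ _ _) (TV i im').
rewrite -PhiE => /(_ quo'); apply=> //.
by have <- : (n + (2 * i - 1) + 1 = n + 2 * i)%N by move: predi; lia.
Qed.

Let singleton_face w K : face Qplus K -> K w -> (Q `&` K `<=` [set w]) ->
  (K ybar -> ybar = w) -> face Qplus [set w].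
Proof.
move=> fK Kw QK Ky; suff <- : K = [set w] by [].
apply/seteqP; split; last by move=> z ->.
move: fK; rewrite QplusE => fK; apply: (face_hull_sub fK).
  by rewrite -hull_set1; exact: hull_cvx.
by move=> z [[Qz|->] Kz]; [exact: QK|exact: Ky].
Qed.

(** For [i = m] the quotient lives in a space with a single point, and there is no x_(i+1) to work
    with; this case is treated apart below. *)
Let dim0_eq (u v : 'rV[R]_(2 * (m - i))) : (m <= i)%N -> u = v.
Proof. by move=> mi; apply/rowP => j; have := ltn_ord j; lia. Qed.

Let dim0_face w : (m <= i)%N -> face Qplus [set w].
Proof.
move=> mi; suff -> : [set w] = Qplus by exact: face_refl.
apply/seteqP; split=> z; last by move=> _; exact: dim0_eq.
by move=> _; rewrite (dim0_eq z ybar mi).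
Qed.

(** Phi_i lies in facets of levels [i] and [i + 1], hence of both parities, so the empty face of Q
    extends to a face through ybar with no other generator. *)
Let face_ybar : face Qplus [set ybar].
Proof.
have [mi|im1] := leqP m i; first exact: dim0_face.
have [H1 [f1 F1 l1]] := facet_of_level im.
have im1' : (1 <= i.+1 <= m)%N by [].
have [H2 [f2 F2 l2]] := facet_of_level im1'.
have Fi : faces_above P (Phi x y i) (Phi x y i) by split=> //; exact: facePhi.
have [||K [fK QK Ky]] := tangentQ Fi f1 F1 f2.
- by move=> v Pv; apply: F2; apply: Phi_mono Pv; lia.
- by rewrite l1 l2 /=; case: odd.
by apply: (singleton_face fK Ky) => //; rewrite QK (quotient_bottom quo).
Qed.

(** By simpliciality [v] is the only vertex of [F] off Phi_i, so [F] misses x_(i+1) or y_(i+1); a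
    facet through [F] missing the same vertex has level [i]. Its parity then lets [belowQ] keep the
    vertex of Q over [v] as a vertex of Q+. *)
Let facet_over_atom v F : (i < m)%N -> vertices P v -> ~ Phi x y i v ->
  atom_above P (Phi x y i) F -> F v ->
  exists H, [/\ facets P H, F `<=` H & lev H = i].
Proof.
move=> im1 Vv iv [[fF iF] Fi atm] Fv.
have FP : F <> P.
  move=> FP; have fi : facets P (Phi x y i).
    apply/facets_coatomP => //; split; [exact: facePhi|exact: Phi_neq|].
    by move=> F' fF' iF'; rewrite -FP; apply: atm; rewrite ?FP //; exact: face_sub.
  by case: fi => _; rewrite dP dimPhi //; lia.
pose A := [set` v :: Phi_vertices x y i].
have AVF : A `<=` vertices P `&` F.
  move=> u; rewrite /A /= inE => /orP[/eqP->//|ui]; split; first exact: PhiV ui.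
  by apply: iF; rewrite PhiE; exact: sub_hull.
have fA : face P (hull A) := simplicial fF FP AVF.
have iA : Phi x y i `<=` hull A.
  by rewrite PhiE; apply: hullS => u ui; rewrite /A /= inE ui orbT.
have FA : hull A = F.
  have Av : hull A v by apply: sub_hull; rewrite /A /= mem_head.
  have [||e|//] := atm (hull A).
  - by split.
  - apply: hull_min; last by move=> u /AVF[].
    exact: cvxP.
  - by case: iv; rewrite -e.
have [xV yV] := @Phi_vertex i.+1 im1; have [xn yn] := Phi_lt im1.
have only_v u : vertices P u -> ~ Phi x y i u -> F u -> u = v.
  move=> Vu iu; rewrite -FA => /(vertex_in_hull Vu).
  have AP : A `<=` P by move=> t /AVF[/vertex_in].
  move=> /(_ AP); rewrite /A /= inE => /orP[/eqP//|ui].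
  by case: iu; rewrite PhiE; exact: sub_hull.
have [u Vu [iu Fu]] : exists2 u, vertices P u & Phi x y i.+1 u /\ ~ F u.
  have [Fx|Fx] := pselect (F (x i.+1)); last first.
    by exists (x i.+1) => //; split=> //; exact: mem_Phi_x.
  exists (y i.+1) => //; split; first exact: mem_Phi_y.
  move=> Fy; have [/(_ i.+1 im1)] := universal_towerP tow.
  by rewrite /= (only_v _ xV xn Fx) (only_v _ yV yn Fy) mem_head.
have [H [fH FH Hu]] := facet_avoiding pP dP fF (vertex_in Vu) Fu.
exists H; split=> //; apply: level_eq => // [z /iF/FH//|_ h].
by apply: Hu; exact: h.
Qed.

Lemma quotient_of_sewn (Q2 : set 'rV[R]_(2 * (m - i)))
    (psi2 : set 'rV[R]_(2 * m) -> set 'rV[R]_(2 * (m - i))) :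
  quotient Pplus G Q2 psi2 ->
  exists phi : 'rV[R]_(2 * (m - i)) -> 'rV[R]_(2 * (m - i)),
    [/\ comb_equiv Qplus Q2 phi,
        forall v, (vertices P `\` vertices (Phi x y i)) v ->
          exists2 w, quotient_vertex P (Phi x y i) psi v w &
                     quotient_vertex Pplus G psi2 v (phi w) &
        quotient_vertex Pplus G psi2 (y i) (phi ybar)].
Proof.
move=> quo2; have [fG pQ2 _ iso2] := quo2.
have [L isoL relL] := lattice_iso_of_rel rel_total rel_surj rel_mono.
have isoT := lattice_iso_comp isoL iso2.
have [phi [ceq phiE]] := lattice_iso_vertices pQplus pQ2 isoT.
have L0 : L set0 = G.
  by apply: rel_bottom; [exact: (lattice_iso_fun isoL (face0 _))|exact: relL (face0 _)].
(* Membership in [G] is read off from the relation at the empty face, where [F] is Phi_i. *)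
have GV v : vertices P v -> v <> y i -> G v -> Phi x y i v.
  have [F [LF FE MF _ _]] := relL _ (face0 Qplus); rewrite -L0 => Vv vy /(MF v Vv vy).
  suff -> : F = Phi x y i by [].
  apply: (lattice_iso_inj iso LF); first by split=> //; exact: facePhi.
  by rewrite FE setI0 (quotient_bottom quo).
have Gy : ~ G (y i).
  by have [F [_ _ _ _ My]] := relL _ (face0 Qplus); rewrite -L0 => /My.
(* [L] carries the atom [[set w]] to an atom above [G], and this is the closure of [G] and any of
   its points off [G]. *)
have closure_vertex u w : face Qplus [set w] -> L [set w] u -> ~ G u ->
    quotient_vertex Pplus G psi2 u (phi w).
  move=> fw Lu Gu; rewrite /quotient_vertex -(phiE w fw).
  rewrite (@face_closure_atom _ _ _ _ (L [set w])) //; split.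
  - exact: (lattice_iso_fun isoL).
  - by move=> e; apply: Gu; rewrite -e.
  move=> F' /(lattice_iso_surj isoL)[K fK <-] /(proj2 isoL _ _ fK fw).
  by move=> /subset_set1[->|->]; [left|right].
exists phi; split=> //; last first.
  apply: closure_vertex => //.
  by have [F [_ _ _ _ My]] := relL _ face_ybar; exact/My.
move=> v [Vv nv]; have iv : ~ Phi x y i v.
  move=> iv; apply: nv; apply: (vertex_of_subset Vv) => //.
  exact: face_sub (facePhi im').
have [F aF Fv] := atom_over Vv iv; have [w Qw Fw] := quotient_atom quo aF.
have LF : faces_above P (Phi x y i) F by case: aF.
exists w; first by rewrite /quotient_vertex (face_closure_atom aF).
have fw : face Qplus [set w].
  have [mi|im1] := leqP m i; first exact: dim0_face.
  have [H [fH FH lH]] := facet_over_atom im1 Vv iv aF Fv.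
  have [|K [fK QK Ky]] := belowQ LF fH FH; first by rewrite lH.
  apply: (singleton_face fK) => //; last by rewrite QK Fw.
  by have : (Q `&` K) w by [rewrite QK Fw]; case.
apply: closure_vertex => //.
  have [F1 [LF1 FE MF _ _]] := relL _ fw; apply/MF => //.
    by move=> e; apply: iv; rewrite e.
  suff -> : F1 = F by [].
  apply: (lattice_iso_inj iso LF1 LF); rewrite FE Fw; apply/seteqP.
  by split=> [z []//|z ->]; split=> //; exact: vertex_in.
by move=> Gv; apply: (iv); apply: GV => // e; apply: (iv); rewrite e.
Qed.

End Main.

Theorem theorem3p1 (R : realType) (m : nat) (P : set 'rV[R]_(2 * m))
    (x y : nat -> 'rV[R]_(2 * m)) (xbar : 'rV[R]_(2 * m))
    (Pplus : set 'rV[R]_(2 * m)) (i : nat)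
    (Q : set 'rV[R]_(2 * (m - i)))
    (psi : set 'rV[R]_(2 * m) -> set 'rV[R]_(2 * (m - i)))
    (ybar : 'rV[R]_(2 * (m - i))) (Qplus : set 'rV[R]_(2 * (m - i))) :
  (1 < m)%N ->
  neighbourly (2 * m) P ->
  `I_(2 * m + 3) #<= vertices P ->
  universal_tower P m x y ->
  sewn P m (Phi x y) xbar Pplus ->
  (1 <= i <= m)%N ->
  quotient P (Phi x y i) Q psi ->
  sewn Q (m - i) (fun j => psi (Phi x y (i + j))) ybar Qplus ->
  let G := hull (Phi x y i.-1 `|` [set x i; xbar]) in
  face Pplus G /\
  forall (Q2 : set 'rV[R]_(2 * (m - i)))
         (psi2 : set 'rV[R]_(2 * m) -> set 'rV[R]_(2 * (m - i))),
    quotient Pplus G Q2 psi2 ->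
    exists phi : 'rV[R]_(2 * (m - i)) -> 'rV[R]_(2 * (m - i)),
      [/\ comb_equiv Qplus Q2 phi,
          forall v, (vertices P `\` vertices (Phi x y i)) v ->
            exists2 w, quotient_vertex P (Phi x y i) psi v w &
                       quotient_vertex Pplus G psi2 v (phi w) &
          quotient_vertex Pplus G psi2 (y i) (phi ybar)].
Proof.
move=> _ nP cV tow sewP im quo sewQ; split.
  exact: face_sewn_tower nP cV tow sewP im quo sewQ.
move=> Q2 psi2; exact: quotient_of_sewn nP cV tow sewP im quo sewQ Q2 psi2.
Qed.
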